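(* Let $n\ge 1$ be a fixed integer and, for each integer $N\ge n$, let $A^\ast=A^\ast(N)=\sqrt{4\log N/n}$. Then $$\lim_{N\to\infty}\mathcal{R}_{n,N}(A^\ast)=\frac12 .$$
   Context: For positive integers $n\le N$ and a real number $A\ge 0$, let $\Theta(A,n,N)$ be the set of matrices $\boldsymbol{\theta}=(\theta_{ij})\in\mathbb{R}^{N\times N}$ for which there exist $R,C\subset\{1,\dots,N\}$ with $|R|=|C|=n$ such that $\theta_{ij}\ge A$ for all $(i,j)\in R\times C$ and $\theta_{ij}=0$ for all other $(i,j)$. For $\boldsymbol{\theta}\in\mathbb{R}^{N\times N}$ let $\mathbb{P}_{\boldsymbol{\theta}}$ denote the law of a random matrix $\mathbf{X}=(X_{ij})_{1\le i,j\le N}$ with independent entries $X_{ij}\sim N(\theta_{ij},1)$, and let $\mathbb{P}_0$ be this law for $\boldsymbol{\theta}=\mathbf{0}$. A test is a measurable function $T=T(\mathbf{X})$ with values in $\{0,1\}$. The minimax risk is $$\mathcal{R}_{n,N}(A)=\inf_{T}\Big\{\mathbb{P}_0(T=1)+\sup_{\boldsymbol{\theta}\in\Theta(A,n,N)}\mathbb{P}_{\boldsymbol{\theta}}(T=0)\Big\},$$ the infimum being over all tests. *)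

(* Defs.v *)
From HB Require Import structures.
From mathcomp Require Import all_boot all_order all_algebra.
From mathcomp Require Import all_classical all_reals all_analysis.

Set Implicit Arguments.
Unset Strict Implicit.
Unset Printing Implicit Defensive.

Import Order.TTheory GRing.Theory Num.Theory.
Import numFieldNormedType.Exports.

Local Open Scope classical_set_scope.
Local Open Scope ring_scope.

Definition measure_matrix_display : measure_display -> measure_display.
Proof. exact. Qed.

(* Matrices carry the product sigma-algebra, the one generated by the entries
   (for real entries, the Borel sets of R^(m x n)). *)
Section measurable_matrix.
Context {d} {T : measurableType d} (m n : nat).

Definition matrix_measurable : set (set 'M[T]_(m, n)) :=
  <<s \bigcup_(ij in [set: 'I_m * 'I_n])
        preimage_set_system setT (fun X : 'M[T]_(m, n) => X ij.1 ij.2)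
          measurable >>.

Let matrix_set0 : matrix_measurable set0.
Proof. exact: sigma_algebra0. Qed.

Let matrix_setC A : matrix_measurable A -> matrix_measurable (~` A).
Proof. exact: sigma_algebraC. Qed.

Let matrix_bigcup (F : (set 'M[T]_(m, n))^nat) :
  (forall i, matrix_measurable (F i)) -> matrix_measurable (\bigcup_i (F i)).
Proof. exact: sigma_algebra_bigcup. Qed.

HB.instance Definition _ := @isMeasurable.Build (measure_matrix_display d)
  'M[T]_(m, n) matrix_measurable matrix_set0 matrix_setC matrix_bigcup.

End measurable_matrix.

Lemma measurable_entry d (T : measurableType d) m n (i : 'I_m) (j : 'I_n) :
  measurable_fun [set: 'M[T]_(m, n)] (fun X => X i j).
Proof.
move=> _ Y mY; apply: sub_sigma_algebra.
by exists (i, j) => //; exists Y.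
Qed.

Lemma measurable_fun_matrixP d d' (S : measurableType d) (T : measurableType d')
    m n (f : S -> 'M[T]_(m, n)) :
  measurable_fun [set: S] f <->
  forall i j, measurable_fun [set: S] (fun x => f x i j).
Proof.
split=> [mf i j|mf].
  by apply: (measurableT_comp (@measurable_entry _ T m n i j)).
apply: (@measurability _ _ _ _ _ _ (\bigcup_(ij in [set: 'I_m * 'I_n])
  preimage_set_system setT (fun X : 'M[T]_(m, n) => X ij.1 ij.2) measurable)) => //.
move=> _ [_ [[i j] _ [B mB <-]] <-] /=.
by have := mf i j measurableT B mB; rewrite !setTI.
Qed.

Section tuple_product.
Context {d} {T : measurableType d} {R : realType}.

Definition tuple_cons n (x : T * n.-tuple T) : n.+1.-tuple T :=
  [tuple of x.1 :: x.2].

Lemma measurable_tuple_cons n : measurable_fun setT (@tuple_cons n).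
Proof. exact: measurable_cons. Qed.

HB.instance Definition _ n :=
  isMeasurableFun.Build _ _ _ _ (@tuple_cons n) (@measurable_tuple_cons n).

(* Law of (x_0, ..., x_(n-1)) for independent x_i with laws P i. *)
Fixpoint tuple_prob n : ('I_n -> probability T R) -> probability (n.-tuple T) R :=
  match n with
  | 0 => fun _ => dirac [tuple]
  | n'.+1 => fun P =>
      distribution (P ord0 \x tuple_prob (fun i => P (lift ord0 i)))%E
                   (@tuple_cons n')
  end.

Lemma tuple_prob_rect n (P : 'I_n -> probability T R) (B : 'I_n -> set T) :
  (forall i, measurable (B i)) ->
  tuple_prob P [set t | forall i, B i (tnth t i)] = (\prod_(i < n) P i (B i))%E.
Proof.
elim: n P B => [|n IH] P B mB /=.
  rewrite big_ord0 diracE mem_set//.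
  by case.
rewrite big_ord_recl -IH// -product_measure1E//.
  rewrite /distribution /pushforward; congr (product_measure1 _ _ _).
  apply/seteqP; split=> [[x t]/= H|[x t]/= [H0 H] i].
    by split=> [|i]; [have := H ord0|have := H (lift ord0 i); rewrite /= tnthS].
  by case: (unliftP ord0 i) => [j|] ->; rewrite ?tnthS.
rewrite (_ : mkset _ =
    \bigcap_(i in [set: 'I_n]) ((@tnth n T ^~ i) @^-1` B (lift ord0 i))).
  apply: fin_bigcap_measurable => // i _.
  by rewrite -[X in measurable X]setTI; apply: measurable_tnth.
by apply/seteqP; split=> [t H i _|t H i]; exact: H.
Qed.

End tuple_product.

Section matrix_product.
Context {d} {T : measurableType d} {R : realType} (m n : nat).

Definition tuple_matrix (t : (m * n).-tuple T) : 'M[T]_(m, n) :=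
  \matrix_(i, j) tnth t (mxvec_index i j).

Lemma measurable_tuple_matrix : measurable_fun setT tuple_matrix.
Proof.
apply/measurable_fun_matrixP => i j.
under eq_fun do rewrite mxE.
exact: measurable_tnth.
Qed.

HB.instance Definition _ :=
  isMeasurableFun.Build _ _ _ _ tuple_matrix measurable_tuple_matrix.

(* Law of a random matrix with independent entries X i j of laws P i j; see
   matrix_prob_rect. *)
Definition matrix_prob (P : 'I_m -> 'I_n -> probability T R) :
    probability 'M[T]_(m, n) R :=
  distribution
    (tuple_prob (fun k => let ij := enum_val (cast_ord (esym (mxvec_cast m n)) k)
                          in P ij.1 ij.2))
    tuple_matrix.

Lemma matrix_prob_rect (P : 'I_m -> 'I_n -> probability T R)
    (B : 'I_m -> 'I_n -> set T) :
  (forall i j, measurable (B i j)) ->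
  matrix_prob P [set X | forall i j, B i j (X i j)] =
  (\prod_(i < m) \prod_(j < n) P i j (B i j))%E.
Proof.
move=> mB; rewrite /matrix_prob /distribution /pushforward.
set u := fun k : 'I_(m * n) => enum_val (cast_ord (esym (mxvec_cast m n)) k).
have uK i j : u (mxvec_index i j) = (i, j).
  by rewrite /u /mxvec_index cast_ordK enum_rankK.
have Ku k : mxvec_index (u k).1 (u k).2 = k.
  by case/mxvec_indexP: k => i j; rewrite uK.
transitivity (tuple_prob (fun k => P (u k).1 (u k).2)
    [set t | forall k, B (u k).1 (u k).2 (tnth t k)]).
  congr (tuple_prob _ _); apply/seteqP; split=> [t H k|t H i j] /=.
    by have := H (u k).1 (u k).2; rewrite mxE Ku.
  by have := H (mxvec_index i j); rewrite uK mxE.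
rewrite (@tuple_prob_rect _ _ _ _ _ (fun k => B (u k).1 (u k).2))//.
rewrite pair_big/= (reindex u)//=.
by exists (fun p => mxvec_index p.1 p.2) => [k|[i j]] _ //=; rewrite uK.
Qed.

End matrix_product.

Section gaussian.
Context {R : realType}.

Definition idTR : measurableTypeR R -> R := idfun.

HB.instance Definition _ :=
  @isMeasurableFun.Build _ _ _ _ idTR (@measurable_id _ _ setT).

(* N(mu, 1), whose standard deviation is the second argument of normal_prob.
   That measure lives on measurableTypeR R, which has the same measurable sets
   as the canonical measurableType structure of R but another display; the image
   by the identity moves it to R. *)
Definition gaussian_prob (mu : R) : probability R R :=
  distribution (normal_prob mu 1) idTR.

Lemma gaussian_probE (mu : R) (B : set R) :
  gaussian_prob mu B = normal_prob mu 1 B.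
Proof. by []. Qed.

Definition gaussian_matrix_prob (N : nat) (theta : 'M[R]_N) :
    probability 'M[R]_N R :=
  matrix_prob (fun i j => gaussian_prob (theta i j)).

Lemma gaussian_matrix_prob_rect N (theta : 'M[R]_N) (B : 'I_N -> 'I_N -> set R) :
  (forall i j, measurable (B i j)) ->
  gaussian_matrix_prob theta [set X | forall i j, B i j (X i j)] =
  (\prod_(i < N) \prod_(j < N) normal_prob (theta i j) 1 (B i j))%E.
Proof. exact: matrix_prob_rect. Qed.

End gaussian.

Definition Theta (R : realType) (A : R) (n N : nat) : set 'M[R]_N :=
  [set theta | exists Rw Cl : {set 'I_N},
    [/\ #|Rw| = n, #|Cl| = n,
        forall i j, i \in Rw -> j \in Cl -> A <= theta i j
      & forall i j, ~~ ((i \in Rw) && (j \in Cl)) -> theta i j = 0]].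
Arguments Theta {R} A n N _.

(* A test takes the value true when it rejects theta = 0. *)
Definition minimax_risk (R : realType) (n N : nat) (A : R) : \bar R :=
  ereal_inf [set (gaussian_matrix_prob (0 : 'M[R]_N) [set X | T X = true]
     + ereal_sup [set gaussian_matrix_prob theta [set X | T X = false]
                 | theta in Theta A n N])%E
    | T in [set T : 'M[R]_N -> bool | measurable_fun setT T]].

(* Main.v *)
Require Import Defs.
From HB Require Import structures.
From mathcomp Require Import all_boot all_order all_algebra.
From mathcomp Require Import all_classical all_reals all_analysis.
From mathcomp Require Import measurable_realfun ring lra.
Set Implicit Arguments.
Unset Strict Implicit.
Unset Printing Implicit Defensive.
Import Order.TTheory GRing.Theory Num.Theory.
Import numFieldNormedType.Exports.
Local Open Scope classical_set_scope.
Local Open Scope ring_scope.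

(** Write [P_theta] for the Gaussian law with mean [theta], [<v, X>] for the
    entrywise inner product of matrices, and [1_b] for the indicator matrix of
    an n x n block [b]; thus [<1_b, X>] is the sum of the entries of [X] in [b],
    of variance [n ^ 2]. At [A = sqrt (4 ln N / n)] the level [A * n ^ 2], which
    is the mean of the block sum when the signal is exactly [A], is also the
    first-order size of the maximum of all block sums under [P_0]. At this level
    a test can miss a signal only through the sign of a centred Gaussian, which
    is where the 1/2 comes from.

    Upper bound. Reject when some block sum is at least [A * n ^ 2]. A signal on
    [b] raises the mean of the sum over [b] to at least [A * n ^ 2], so it is
    missed with probability at most 1/2. A false alarm has, by the union bound,
    probability at most [N ^ (2 n)] times a Gaussian tail; the exponential part
    of this tail is exactly [N ^ (- 2 n)], and what makes the product vanish is
    the additional factor that a Gaussian tail has beyond its exponential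
    ([sharp_tail]).

    Lower bound. The worst case is bounded below by the average over a uniformly
    chosen block with signal [A]. The likelihood ratio of the mixture has too
    large a variance, but truncating the ratio of each block [b] to the event
    [<1_b, X> < A * n ^ 2] leaves a mean of 1/2, and then the variance tends to
    0. For two blocks sharing [r] rows and [c] columns, the Chernoff bound for
    the sum of the two block sums gives a contribution
      [exp (A ^ 2 * n ^ 2 * r c / (n ^ 2 + r c))
          = N ^ (4 n r c / (n ^ 2 + r c))]
    for a proportion [O (N ^ (- (r + c)))] of the pairs, and
      [(r + c) (n ^ 2 + r c) - 4 n r c = r (n - c) ^ 2 + c (n - r) ^ 2]
    is positive unless [r = c = n] ([exponent_gap]). In the remaining case of
    two equal blocks the two exponents coincide and the sharp tail is needed
    again. Disjoint blocks contribute at most 1/4, the square of the mean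
    ([gaussian_orthant_le]). A pointwise quadratic inequality
    ([truncated_second_moment]) turns the two moments into a bound on the risk.

    All facts about the Gaussian law come from three of its properties, which
    pass from one entry to the whole matrix: translating the observation shifts
    the mean, changing the signs of entries preserves [P_0], and [P_theta] has
    density [exp (<theta, X> - |theta| ^ 2 / 2)] with respect to [P_0]. In
    particular the law of a linear form [<v, X>] is never computed. *)

(** * Images of weighted product measures *)

(** The measure [nu] is the image under [phi] of the measure with density [g]
    with respect to [mu]. Testing against all nonnegative functions, rather than
    sets, is what makes the property stable under products. *)
Definition weighted_image d d' (T : measurableType d) (T' : measurableType d')
    (R : realType) (phi : T -> T') (g : T -> R)
    (mu : set T -> \bar R) (nu : set T' -> \bar R) : Prop :=
  forall f : T' -> \bar R, measurable_fun setT f -> (forall x, 0 <= f x)%E ->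
    (\int[nu]_x f x = \int[mu]_x (f (phi x) * (g x)%:E))%E.

Section weighted_image_sets.
Context d d' (T : measurableType d) (T' : measurableType d') (R : realType).
Variables (phi : T -> T') (g : T -> R).
Variables (mu : {measure set T -> \bar R}) (nu : {measure set T' -> \bar R}).
Hypotheses (mphi : measurable_fun setT phi) (mg : measurable_fun setT g).
Hypothesis g0 : forall x, 0 <= g x.

Import HBNNSimple.

(** Both sides are linear in [f] and continuous along increasing sequences, so
    that the identity for indicators extends to simple functions and then to
    their limits. *)
Lemma weighted_image_of_sets :
  (forall A, measurable A -> nu A = \int[mu]_(x in phi @^-1` A) (g x)%:E)%E ->
  weighted_image phi g mu nu.
Proof.
move=> nuE f mf f0.
have nu_indic A : measurable A ->
    (\int[nu]_x (\1_A x)%:E = \int[mu]_x ((\1_A (phi x))%:E * (g x)%:E))%E.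
  move=> mA; rewrite integral_indic// setIT nuE// integral_mkcond.
  apply: eq_integral => x _; rewrite patchE indicE.
  have -> : (x \in phi @^-1` A) = (phi x \in A) by apply/idP/idP; rewrite !inE.
  by case: ifPn; rewrite ?mul1e ?mul0e.
have mgE : measurable_fun setT (fun x => (g x)%:E) by exact/measurable_EFinP.
have nu_simple (h : {nnsfun T' >-> R}) :
    (\int[nu]_x (h x)%:E = \int[mu]_x ((h (phi x))%:E * (g x)%:E))%E.
  under [LHS]eq_integral do rewrite fimfunE -fsumEFin//.
  rewrite [LHS]ge0_integral_fsum//; last 2 first.
    - by move=> r; exact/measurable_EFinP/measurableT_comp.
    - by move=> r x _; rewrite EFinM nnfun_muleindic_ge0.
  under [RHS]eq_integral.
    move=> x _; rewrite fimfunE -fsumEFin// muleC ge0_mule_fsumr; last first.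
      by move=> r; rewrite EFinM nnfun_muleindic_ge0.
    over.
  have mh r : measurable_fun setT (fun x => (\1_(h @^-1` [set r]) (phi x) : R)).
    by apply: (measurableT_comp _ mphi) => //; apply: measurable_indic.
  rewrite [RHS]ge0_integral_fsum//; last 2 first.
    - move=> r; apply: emeasurable_funM => //.
      by apply/measurable_EFinP; apply: measurable_funM => //.
    - move=> r x _; apply: mule_ge0; first by rewrite lee_fin.
      by rewrite EFinM nnfun_muleindic_ge0.
  apply: eq_fsbigr => r rh.
  have r0 : 0 <= r by move/set_mem: rh => [y _ <-].
  under eq_integral do rewrite EFinM.
  rewrite ge0_integralZl//; last first.
    by apply/measurable_EFinP; apply: measurable_indic.
  rewrite nu_indic// -ge0_integralZl//; first last.
  - by move=> x _; rewrite mule_ge0 ?lee_fin.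
  - by apply: emeasurable_funM => //; apply/measurable_EFinP.
  by apply: eq_integral => x _; rewrite EFinM muleA muleC.
pose f_ := nnsfun_approx measurableT mf.
transitivity (lim (\int[nu]_x (f_ n x)%:E @[n --> \oo])%E).
  rewrite -monotone_convergence//=.
  - apply: eq_integral => ? /[!inE] xD; apply/esym/cvg_lim => //=.
    exact: cvg_nnsfun_approx.
  - by move=> n; exact/measurable_EFinP/measurable_funTS.
  - by move=> n ? _; rewrite lee_fin.
  - by move=> ? _ ? ? mn; rewrite lee_fin; exact/lefP/nd_nnsfun_approx.
under eq_fun do rewrite nu_simple.
rewrite -monotone_convergence//=.
- apply: eq_integral => x _; apply/cvg_lim => //.
  by apply: cvgeZr => //; exact: cvg_nnsfun_approx.
- move=> n; apply: emeasurable_funM => //; apply/measurable_EFinP.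
  exact: (measurableT_comp _ mphi).
- by move=> n x _; rewrite mule_ge0 ?lee_fin.
- move=> x _ m n mn; rewrite lee_wpmul2r ?lee_fin//.
  exact/lefP/nd_nnsfun_approx.
Qed.

End weighted_image_sets.

Lemma weighted_image_set d d' (T : measurableType d) (T' : measurableType d')
    (R : realType) (phi : T -> T') (g : T -> R) 
    (mu : {measure set T -> \bar R}) (nu : {measure set T' -> \bar R}) A :
  weighted_image phi g mu nu -> measurable A ->
  (nu A = \int[mu]_(x in phi @^-1` A) (g x)%:E)%E.
Proof.
move=> H mA; rewrite -[A in LHS]setIT -integral_indic//.
rewrite H//; last by apply/measurable_EFinP; apply: measurable_indic.
rewrite [RHS]integral_mkcond; apply: eq_integral => x _.
rewrite patchE indicE.
have -> : (x \in phi @^-1` A) = (phi x \in A) by apply/idP/idP; rewrite !inE.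
by case: ifPn; rewrite ?mul1e ?mul0e.
Qed.

Section weighted_image_tuple.
Context d (T : measurableType d) (R : realType).

Lemma measurable_prod_tnth n (g : 'I_n -> T -> R) :
  (forall i, measurable_fun setT (g i)) ->
  measurable_fun setT (fun t : n.-tuple T => \prod_(i < n) g i (tnth t i)).
Proof.
move=> mg; apply: measurable_prod => i _.
by apply: measurableT_comp => //; exact: measurable_tnth.
Qed.

Lemma measurable_map_tnth n (phi : 'I_n -> T -> T) :
  (forall i, measurable_fun setT (phi i)) ->
  measurable_fun setT
    (fun t : n.-tuple T => [tuple phi i (tnth t i) | i < n]).
Proof.
move=> mphi; apply/measurable_fun_tnthP => i /=.
rewrite (_ : _ \o _ = phi i \o (@tnth n T)^~ i); last first.
  by apply/funext => t /=; rewrite tnth_mktuple.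
by apply: measurableT_comp => //; exact: measurable_tnth.
Qed.

(** Induction on the length: by Tonelli's theorem the first coordinate can be
    transported while the others are held fixed. *)
Lemma weighted_image_tuple n (P Q : 'I_n -> probability T R)
    (phi : 'I_n -> T -> T) (g : 'I_n -> T -> R) :
  (forall i, measurable_fun setT (phi i)) ->
  (forall i, measurable_fun setT (g i)) ->
  (forall i x, 0 <= g i x) ->
  (forall i, weighted_image (phi i) (g i) (P i) (Q i)) ->
  weighted_image (fun t : n.-tuple T => [tuple phi i (tnth t i) | i < n])
    (fun t => \prod_(i < n) g i (tnth t i)) (tuple_prob P) (tuple_prob Q).
Proof.
elim: n P Q phi g => [|n IH] P Q phi g mphi mg g0 PQ f mf f0 /=.
  rewrite !integral_dirac//; last first.
    apply: emeasurable_funM; last first.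
      by apply/measurable_EFinP; exact: (measurable_prod_tnth mg).
    exact: (measurableT_comp _ (measurable_map_tnth mphi)).
  by rewrite !diracT !mul1e big_ord0 mule1; congr (f _); apply: eq_from_tnth => -[].
set P' := fun i => P (lift ord0 i); set Q' := fun i => Q (lift ord0 i).
have mcons : measurable_fun setT (@tuple_cons _ T n) by exact: measurable_tuple_cons.
set F := fun t : n.+1.-tuple T => (f [tuple phi i (tnth t i) | i < n.+1] *
  (\prod_(i < n.+1) g i (tnth t i))%:E)%E.
have mF : measurable_fun setT F.
  apply: emeasurable_funM.
    exact: (measurableT_comp _ (measurable_map_tnth mphi)).
  by apply/measurable_EFinP; exact: (measurable_prod_tnth mg).
have F0 t : (0 <= F t)%E by rewrite mule_ge0// lee_fin; exact: prodr_ge0.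
rewrite !ge0_integral_pushforward//=; last by move=> t _; exact: F0.
rewrite fubini_tonelli1//=; last exact: (measurableT_comp mf mcons).
rewrite fubini_tonelli1/=; first last.
- by move=> xt; exact: F0.
- exact: (measurableT_comp mF mcons).
rewrite /fubini_F /=.
have mfx x : measurable_fun setT (fun t : n.-tuple T => f [tuple of x :: t]).
  by apply: measurableT_comp => //; exact: measurable_cons.
transitivity (\int[Q ord0]_x \int[tuple_prob P']_t
   (f (tuple_cons (x, [tuple phi (lift ord0 i) (tnth t i) | i < n])) *
     (\prod_(i < n) g (lift ord0 i) (tnth t i))%:E))%E.
  apply: eq_integral => x _.
  exact: (IH P' Q' _ _ (fun i => mphi _) (fun i => mg _) (fun i => g0 _)
    (fun i => PQ _) (fun t => f (tuple_cons (x, t))) (mfx x) (fun t => f0 _)).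
have mphi' : measurable_fun setT
    (fun t : n.-tuple T => [tuple phi (lift ord0 i) (tnth t i) | i < n]).
  exact: (measurable_map_tnth (fun i => mphi (lift ord0 i))).
have mg' : measurable_fun setT
    (fun t : n.-tuple T => (\prod_(i < n) g (lift ord0 i) (tnth t i))%:E).
  by apply/measurable_EFinP; exact: (measurable_prod_tnth (fun i => mg (lift ord0 i))).
have g0' (t : n.-tuple T) : 0 <= \prod_(i < n) g (lift ord0 i) (tnth t i).
  exact: prodr_ge0.
pose h xt := (f (tuple_cons (xt.1, [tuple phi (lift ord0 i) (tnth xt.2 i) | i < n]))
  * (\prod_(i < n) g (lift ord0 i) (tnth xt.2 i))%:E)%E.
have mh : measurable_fun setT h.
  apply: emeasurable_funM; last exact: (measurableT_comp mg' measurable_snd).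
  apply: (measurableT_comp mf); apply: measurable_cons.
    exact: measurable_fst.
  exact: (measurableT_comp mphi' measurable_snd).
have h0 xt : (0 <= h xt)%E by rewrite mule_ge0// lee_fin.
rewrite PQ; first last.
- by move=> x; apply: integral_ge0 => t _; exact: (h0 (x, t)).
- exact: (measurable_fun_fubini_tonelli_F h mh h0).
apply: eq_integral => x _; rewrite -ge0_integralZr//; first last.
- by rewrite lee_fin.
- by move=> t _; rewrite mule_ge0// lee_fin.
- by apply: emeasurable_funM => //; exact: (measurableT_comp (mfx _) mphi').
apply: eq_integral => t _; rewrite big_ord_recl /= -muleA -EFinM mulrC.
rewrite /tuple_cons /= tnth0; congr (_ * _)%E.
  congr f; apply: eq_from_tnth => i; rewrite tnth_mktuple.
  by case: (unliftP ord0 i) => [j|] ->; rewrite ?tnthS ?tnth0 ?tnth_mktuple.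
by congr (_ * _)%:E; apply: eq_bigr => i _; rewrite tnthS.
Qed.

End weighted_image_tuple.

Section weighted_image_matrix.
Context d (T : measurableType d) (R : realType) (m n : nat).

(** A matrix law is the law of a tuple listing the entries, so this is the
    statement for tuples read through that enumeration. *)
Lemma weighted_image_matrix (P Q : 'I_m -> 'I_n -> probability T R)
    (phi : 'I_m -> 'I_n -> T -> T) (g : 'I_m -> 'I_n -> T -> R) :
  (forall i j, measurable_fun setT (phi i j)) ->
  (forall i j, measurable_fun setT (g i j)) ->
  (forall i j x, 0 <= g i j x) ->
  (forall i j, weighted_image (phi i j) (g i j) (P i j) (Q i j)) ->
  weighted_image (fun X : 'M[T]_(m, n) => \matrix_(i, j) phi i j (X i j))
    (fun X => \prod_(i < m) \prod_(j < n) g i j (X i j))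
    (matrix_prob P) (matrix_prob Q).
Proof.
move=> mphi mg g0 PQ f mf f0.
have mtm : measurable_fun setT (@tuple_matrix _ T m n).
  exact: measurable_tuple_matrix.
(* [u] lists the index pairs in the order in which [tuple_matrix] reads them. *)
pose u (k : 'I_(m * n)) : 'I_m * 'I_n :=
  enum_val (cast_ord (esym (mxvec_cast m n)) k).
have uK i j : u (mxvec_index i j) = (i, j).
  by rewrite /u /mxvec_index cast_ordK enum_rankK.
set F := fun X : 'M[T]_(m, n) => (f (\matrix_(i, j) phi i j (X i j)) *
  (\prod_(i < m) \prod_(j < n) g i j (X i j))%:E)%E.
have mF : measurable_fun setT F.
  apply: emeasurable_funM.
    apply: (measurableT_comp mf); apply/measurable_fun_matrixP => i j.
    under eq_fun do rewrite mxE.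
    exact: (measurableT_comp (mphi i j) (measurable_entry i j)).
  apply/measurable_EFinP; apply: measurable_prod => i _.
  apply: measurable_prod => j _.
  exact: (measurableT_comp (mg i j) (measurable_entry i j)).
have F0 X : (0 <= F X)%E.
  by rewrite mule_ge0// lee_fin; apply: prodr_ge0 => i _; exact: prodr_ge0.
rewrite /matrix_prob !ge0_integral_pushforward//=; last by move=> X _; exact: F0.
rewrite (@weighted_image_tuple _ _ _ _ _
  (fun k => Q (u k).1 (u k).2) (fun k => phi (u k).1 (u k).2)
  (fun k => g (u k).1 (u k).2) _ _ _ (fun k => PQ _ _))//; last first.
  exact: (measurableT_comp mf mtm).
apply: eq_integral => t _; rewrite /= /F; congr (f _ * _%:E)%E.
  by apply/matrixP => i j; rewrite !mxE tnth_mktuple uK.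
rewrite pair_big/= (reindex u)/=; last first.
  exists (fun p => mxvec_index p.1 p.2) => [k|[i j]] _ /=; last by rewrite uK.
  by case/mxvec_indexP: k => i j; rewrite uK.
apply: eq_bigr => k _; case/mxvec_indexP: k => i j.
by rewrite uK /= mxE.
Qed.

End weighted_image_matrix.

(** * The Gaussian law: shifts, sign changes and exponential tilting *)

Section gaussian_line.
Context {R : realType}.
Local Notation mu := (@lebesgue_measure R).

Lemma measurable_signed_shift (s a : R) :
  measurable_fun setT (fun x : R => s * x + a).
Proof. by apply: measurable_funD => //; exact: measurable_funM. Qed.

Lemma lebesgue_measure_signed_shift (s a : R) (A : set (measurableTypeR R)) :
  s ^+ 2 = 1 -> measurable A -> mu ((fun x => s * x + a) @^-1` A) = mu A.
Proof.
move=> /eqP; rewrite sqrf_eq1 => s1 mA.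
have mphi : measurable_fun setT
    ((fun x => s * x + a) : measurableTypeR R -> measurableTypeR R).
  by apply: measurable_funD => //; exact: measurable_funM.
pose phi : {mfun measurableTypeR R >-> measurableTypeR R} :=
  HB.pack (fun x : measurableTypeR R => s * x + a)
          (isMeasurableFun.Build _ _ _ _ _ mphi).
rewrite -[LHS]/(pushforward mu phi A).
apply/esym/lebesgue_measure_unique => //= _ [[b c]] _ <-.
rewrite /pushforward /=.
case/orP: s1 => /eqP s1.
  have -> : phi @^-1` `]b, c]%classic = `]b - a, c - a]%classic.
    by apply/seteqP; split=> x; rewrite /= !in_itv /= s1; lra.
  rewrite !lebesgue_measure_itv /= !lte_fin ltrD2r; case: ifP => // _.
  by rewrite -!EFinB; congr _%:E; ring.
have -> : phi @^-1` `]b, c]%classic = `[a - c, a - b[%classic.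
  by apply/seteqP; split=> x; rewrite /= !in_itv /= s1; lra.
rewrite !lebesgue_measure_itv /= !lte_fin ltrD2l ltrN2; case: ifP => // _.
by rewrite -!EFinB; congr _%:E; ring.
Qed.

Lemma normal_pdf1E (m x : R) :
  normal_pdf m 1 x = normal_peak 1 * expR (- (x - m) ^+ 2 / 2).
Proof. by rewrite normal_pdfE ?oner_neq0// /normal_fun expr1n. Qed.

Lemma weighted_image_normal (m : R) :
  weighted_image (@idTR R) (normal_pdf m 1) mu (gaussian_prob m).
Proof.
apply: weighted_image_of_sets.
- exact: measurable_funPT.
- exact: measurable_normal_pdf.
- by move=> x; exact: normal_pdf_ge0.
- by move=> A mA.
Qed.

(** For [s = 1] this is a translation and for [s = -1], [a = 0] it is the
    symmetry of the centred law: both preserve Lebesgue measure and match the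
    densities. *)
Lemma gaussian_prob_signed_shift (s a : R) : s ^+ 2 = 1 ->
  weighted_image (fun x => s * x + a) (cst 1) (gaussian_prob 0) (gaussian_prob a).
Proof.
move=> s1 f mf f0.
rewrite (weighted_image_normal a mf)// (weighted_image_normal 0); first last.
- by move=> x; rewrite mule1.
- under eq_fun do rewrite mule1.
  exact: (measurableT_comp mf (measurable_signed_shift s a)).
have mphi : measurable_fun setT
    ((fun x => s * x + a) : measurableTypeR R -> measurableTypeR R).
  by apply: measurable_funD => //; exact: measurable_funM.
pose phi : {mfun measurableTypeR R >-> measurableTypeR R} :=
  HB.pack (fun x : measurableTypeR R => s * x + a)
          (isMeasurableFun.Build _ _ _ _ _ mphi).
transitivity (\int[pushforward mu phi]_x (f (idTR x) * (normal_pdf a 1 x)%:E))%E.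
  apply: eq_measure_integral => A mA _.
  by rewrite /pushforward /=; exact/esym/lebesgue_measure_signed_shift.
rewrite ge0_integral_pushforward//=; first last.
- by move=> x _; rewrite mule_ge0// lee_fin normal_pdf_ge0.
- apply: emeasurable_funM => //.
  by apply/measurable_EFinP; exact: measurable_normal_pdf.
apply: eq_integral => x _; rewrite mule1 !normal_pdf1E; do 4 f_equal.
by rewrite addrK subr0 exprMn s1 mul1r.
Qed.

(** The quotient of the densities of N(a, 1) and N(0, 1) at [x] is
    [exp (a x - a ^ 2 / 2)]. *)
Lemma gaussian_prob_tilt (a : R) :
  weighted_image id (fun x => expR (a * x - a ^+ 2 / 2))
    (gaussian_prob 0) (gaussian_prob a).
Proof.
move=> f mf f0.
have mg : measurable_fun setT (fun x : R => expR (a * x - a ^+ 2 / 2)).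
  apply: (measurableT_comp (@measurable_expR R)).
  by apply: measurable_funB => //; exact: measurable_funM.
rewrite (weighted_image_normal a mf)// (weighted_image_normal 0); first last.
- by move=> x; rewrite mule_ge0// lee_fin expR_ge0.
- by apply: emeasurable_funM => //; exact/measurable_EFinP.
apply: eq_integral => x _; rewrite -muleA -EFinM !normal_pdf1E; do 2 f_equal.
rewrite /idTR /= mulrCA -expRD; by congr (_ * expR _); field.
Qed.

End gaussian_line.

Section gaussian_matrix.
Context {R : realType} (N : nat).
Implicit Types (v w theta X : 'M[R]_N).

Definition inner v X : R := \sum_i \sum_j v i j * X i j.

Lemma innerC v X : inner v X = inner X v.
Proof. by apply: eq_bigr => i _; apply: eq_bigr => j _; rewrite mulrC. Qed.

Lemma innerDr v X Y : inner v (X + Y) = inner v X + inner v Y.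
Proof.
rewrite /inner -big_split; apply: eq_bigr => i _ /=.
by rewrite -big_split; apply: eq_bigr => j _ /=; rewrite mxE mulrDr.
Qed.

Lemma innerZr v a X : inner v (a *: X) = a * inner v X.
Proof.
rewrite /inner mulr_sumr; apply: eq_bigr => i _.
by rewrite mulr_sumr; apply: eq_bigr => j _; rewrite mxE mulrCA.
Qed.

Lemma innerDl v w X : inner (v + w) X = inner v X + inner w X.
Proof. by rewrite innerC innerDr !(innerC X). Qed.

Lemma innerZl v a X : inner (a *: v) X = a * inner v X.
Proof. by rewrite innerC innerZr (innerC X). Qed.

Lemma inner_ge0 v : 0 <= inner v v.
Proof. by apply: sumr_ge0 => i _; apply: sumr_ge0 => j _; exact: sqr_ge0. Qed.

Lemma measurable_inner v : measurable_fun setT (inner v).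
Proof.
apply: measurable_sum => i; apply: measurable_sum => j.
by apply: measurable_funM => //; exact: measurable_entry.
Qed.

Lemma measurable_inner_preimage v (B : set R) :
  measurable B -> measurable (inner v @^-1` B).
Proof.
by move=> mB; rewrite -[X in measurable X]setTI; exact: measurable_inner.
Qed.

Lemma gaussian_matrix_signed_shift (s theta : 'M[R]_N) (A : set 'M[R]_N) :
  (forall i j, s i j ^+ 2 = 1) -> measurable A ->
  gaussian_matrix_prob theta A =
  gaussian_matrix_prob 0
    ((fun X : 'M[R]_N => \matrix_(i, j) (s i j * X i j + theta i j)) @^-1` A).
Proof.
move=> s1 mA.
have := @weighted_image_matrix _ R R N N (fun i j => gaussian_prob 0)
  (fun i j => gaussian_prob (theta i j))
  (fun i j x => s i j * x + theta i j) (fun i j => cst 1)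
  (fun i j => measurable_signed_shift _ _) (fun i j => measurable_cst _)
  (fun i j _ => ler01) (fun i j => gaussian_prob_signed_shift _ (s1 i j)).
have -> : gaussian_matrix_prob 0 = matrix_prob (fun i j : 'I_N => gaussian_prob (0 : R)).
  by congr matrix_prob; apply/funext => i; apply/funext => j; rewrite mxE.
move=> /(@weighted_image_set _ _ _ _ _ _ _ _ _ _) H; rewrite [LHS]H//.
under eq_integral => X _.
  rewrite big1 => [|i _]; last by rewrite big1.
  over.
rewrite integral_cst ?mul1e//.
have mphi : measurable_fun setT
    (fun X : 'M[R]_N => \matrix_(i, j) (s i j * X i j + theta i j)).
  apply/measurable_fun_matrixP => i j; under eq_fun do rewrite mxE.
  apply: (measurableT_comp (measurable_signed_shift (s i j) (theta i j))).
  exact: measurable_entry.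
by rewrite -[X in measurable X]setTI; exact: mphi.
Qed.

Lemma gaussian_matrix_shift theta (A : set 'M[R]_N) : measurable A ->
  gaussian_matrix_prob theta A =
  gaussian_matrix_prob 0 [set X | A (X + theta)].
Proof.
move=> mA; rewrite (@gaussian_matrix_signed_shift (const_mx 1))//; last first.
  by move=> i j; rewrite mxE expr1n.
congr (gaussian_matrix_prob _ _); apply/funext => X /=; congr A.
by apply/matrixP => i j; rewrite !mxE mul1r.
Qed.

(** The one-dimensional densities multiply, and the product of exponentials is
    the exponential of the inner product. *)
Lemma gaussian_matrix_tilt theta (A : set 'M[R]_N) : measurable A ->
  (gaussian_matrix_prob theta A =
  \int[gaussian_matrix_prob (0 : 'M[R]_N)]_(X in A)
     (expR (inner theta X - inner theta theta / 2))%:E)%E.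
Proof.
move=> mA.
have mg i j : measurable_fun setT
    (fun x : R => expR (theta i j * x - theta i j ^+ 2 / 2)).
  apply: (measurableT_comp (@measurable_expR R)).
  by apply: measurable_funB => //; exact: measurable_funM.
have := @weighted_image_matrix _ R R N N (fun i j => gaussian_prob 0)
  (fun i j => gaussian_prob (theta i j)) (fun i j => id) _
  (fun i j => @measurable_id _ _ setT) mg
  (fun i j _ => expR_ge0 _) (fun i j => gaussian_prob_tilt (theta i j)).
have -> : gaussian_matrix_prob 0 = matrix_prob (fun i j : 'I_N => gaussian_prob (0 : R)).
  by congr matrix_prob; apply/funext => i; apply/funext => j; rewrite mxE.
move=> /(@weighted_image_set _ _ _ _ _ _ _ _ _ _) H; rewrite [LHS]H//.
rewrite (_ : _ @^-1` A = A); last first.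
  by apply/funext => X /=; congr A; apply/matrixP => i j; rewrite mxE.
apply: eq_integral => X _; congr _%:E.
rewrite /inner mulr_suml -sumrB expR_sum; apply: eq_bigr => i _.
by rewrite mulr_suml -sumrB expR_sum; apply: eq_bigr => j _; rewrite expr2.
Qed.

End gaussian_matrix.

(** * Tails of linear forms of a Gaussian matrix *)

Section half_spaces.
Context {R : realType} (N : nat).
Implicit Types (v w X : 'M[R]_N).
Local Notation P0 := (gaussian_matrix_prob (0 : 'M[R]_N)).

Lemma innerNl v X : inner (- v) X = - inner v X.
Proof. by rewrite -scaleN1r innerZl mulN1r. Qed.

Lemma measurable_tilt v (D : set 'M[R]_N) (c : R) :
  measurable_fun D (fun X => (expR (inner v X - c))%:E).
Proof.
apply: measurable_funTS; apply/measurable_EFinP.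
apply: (measurableT_comp (@measurable_expR R)).
by apply: measurable_funB => //; exact: measurable_inner.
Qed.

Lemma gaussian_shift_inner v theta (I : set R) : measurable I ->
  gaussian_matrix_prob theta (inner v @^-1` I) =
  P0 [set X | I (inner v X + inner v theta)].
Proof.
move=> mI; rewrite gaussian_matrix_shift; last exact: measurable_inner_preimage.
by congr (P0 _); apply/funext => X; rewrite /preimage /= innerDr.
Qed.

(** The density of [P_v] with respect to [P_0] is at most
    [exp (c - |v| ^ 2 / 2)] where [<v, X> <= c]. *)
Lemma gaussian_tilt_le v (A : set 'M[R]_N) (c : R) : measurable A ->
  (forall X, A X -> inner v X <= c) ->
  (gaussian_matrix_prob v A <= (expR (c - inner v v / 2))%:E * P0 A)%E.
Proof.
move=> mA Ac; rewrite gaussian_matrix_tilt// -integral_cst//.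
apply: ge0_le_integral => //.
- exact: measurable_tilt.
- by move=> X /Ac ?; rewrite lee_fin ler_expR lerD2r.
Qed.

(** Let [s = |v| ^ 2]. The shift by [(k / K) v] moves the slab
    [0 <= <v, X> < s / K] to the slab between [k s / K] and [(k + 1) s / K], at
    the cost of a density of at most [exp s] as long as [k < K]. The [K] slabs
    are disjoint, so their probabilities add up to at most 1. *)
Lemma anticoncentration v (K : nat) : (0 < K)%N ->
  (K%:R%:E * P0 (inner v @^-1` `[0%R, (inner v v / K%:R)%R[)
   <= (expR (inner v v))%:E)%E.
Proof.
move=> K0; set s := inner v v; have s0 : 0 <= s by exact: inner_ge0.
have K0' : 0 < K%:R :> R by rewrite ltr0n.
pose I (k : nat) : set R := `[(k%:R / K%:R * s)%R, (k.+1%:R / K%:R * s)%R[%classic.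
have mI k : measurable (inner v @^-1` I k).
  by apply: measurable_inner_preimage; exact: measurable_itv.
have I0 k : (k < K)%N ->
    (P0 (inner v @^-1` `[0%R, (s / K%:R)%R[) <=
     (expR s)%:E * P0 (inner v @^-1` I k))%E.
  move=> kK; pose a : R := k%:R / K%:R.
  have a0 : 0 <= a by rewrite divr_ge0.
  have a1 : a <= 1 by rewrite ler_pdivrMr// mul1r ler_nat ltnW.
  have a1' : k.+1%:R / K%:R <= 1 :> R by rewrite ler_pdivrMr// mul1r ler_nat.
  rewrite (_ : P0 _ = gaussian_matrix_prob (a *: v) (inner v @^-1` I k)); last first.
    rewrite [RHS](gaussian_shift_inner v (a *: v) (I := I k)); last exact: measurable_itv.
    congr (P0 _); apply/seteqP; split=> X; rewrite /I /= !in_itv /= innerZr -/s -/a.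
      move=> /andP[h1 h2]; rewrite lerDr h1/=.
      by rewrite -natr1 mulrDl mulrDl -/a mul1r addrC ltrD2l mulrC.
    rewrite lerDr => /andP[-> /=].
    by rewrite -natr1 mulrDl mulrDl -/a mul1r addrC ltrD2l mulrC.
  apply: le_trans (gaussian_tilt_le (c := s) (mI k) _) _.
    move=> X; rewrite /I /= in_itv /= innerZl => /andP[h1 h2].
    have h3 : inner v X <= s by nra.
    have h4 : 0 <= inner v X by apply: le_trans h1; rewrite mulr_ge0.
    nra.
  apply: lee_wpmul2r => //; rewrite lee_fin ler_expR lerBlDr lerDl.
  by rewrite divr_ge0// inner_ge0.
have tI : trivIset setT (fun k => inner v @^-1` I k).
  apply: ltn_trivIset => j i ij; rewrite -subset0 => X [] /=.
  rewrite /I /= !in_itv /= => /andP[h1 h2] /andP[h3 h4].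
  have : i.+1%:R / K%:R * s <= j%:R / K%:R * s.
    by rewrite ler_wpM2r// ler_wpM2r ?invr_ge0// ler_nat.
  lra.
rewrite -[leRHS]mule1; apply: (@le_trans _ _ ((expR s)%:E * 
    P0 (\big[setU/set0]_(k < K) (inner v @^-1` I k)))%E); last first.
  apply: lee_wpmul2l; first by rewrite lee_fin expR_ge0.
  by apply: probability_le1; exact: bigsetU_measurable.
rewrite (@measure_bigsetU _ _ _ P0 _ mI tI)// ge0_sume_distrr//.
apply: (@le_trans _ _ (\sum_(k < K) P0 (inner v @^-1` `[0%R, (s / K%:R)%R[))%E).
  have : P0 (inner v @^-1` `[0%R, (s / K%:R)%R[) \is a fin_num.
    by rewrite fin_num_measure//; apply: measurable_inner_preimage; exact: measurable_itv.
  move=> /fineK <-; rewrite sumEFin sumr_const card_ord -EFinM lee_fin.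
  by rewrite mulr_natl.
by apply: lee_sum => k _; exact: I0.
Qed.

(** Shifting by [- t v] turns the tail event into the half-space [0 <= <v, X>],
    on which the density is [exp (- t ^ 2 s / 2)] times [exp (- t <v, X>)], with
    [s = |v| ^ 2]; the last factor is bounded by 1 on the slab
    [0 <= <v, X> < delta] and by [exp (- t delta)] beyond it. *)
Lemma gaussian_tail v (t delta : R) : 0 <= t -> 0 <= delta ->
  (P0 (inner v @^-1` `[(t * inner v v)%R, +oo[) <=
   (expR (- (t ^+ 2 * inner v v / 2)))%:E *
   (P0 (inner v @^-1` `[0%R, delta[) + (expR (- (t * delta)))%:E))%E.
Proof.
move=> t0 delta0; set s := inner v v.
have mA : measurable (inner v @^-1` `[0%R, delta[).
  by apply: measurable_inner_preimage; exact: measurable_itv.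
have mB : measurable (inner v @^-1` `[delta, +oo[).
  by apply: measurable_inner_preimage; exact: measurable_itv.
rewrite (_ : P0 _ =
    gaussian_matrix_prob (- t *: v) (inner v @^-1` `[0%R, +oo[)); last first.
  rewrite [RHS](gaussian_shift_inner v (- t *: v)); last exact: measurable_itv.
  congr (P0 _); apply/seteqP; split=> X; rewrite /= !in_itv /= !andbT innerZr -/s;
    by rewrite mulNr subr_ge0.
rewrite (_ : inner v @^-1` `[0%R, +oo[%classic =
    inner v @^-1` `[0%R, delta[ `|` inner v @^-1` `[delta, +oo[); last first.
  rewrite -preimage_setU; congr (_ @^-1` _); apply/seteqP; split=> x /=;
    rewrite !in_itv /= !andbT.
    by case: (ltP x delta) => h h0; [left; rewrite h0 | right].
  by case=> [/andP[]//|]; exact: le_trans.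
apply: le_trans (measureU2 _ mA mB) _.
have ss : inner (- t *: v) (- t *: v) = t ^+ 2 * s.
  by rewrite innerZl innerZr -/s; ring.
rewrite muleDr// ?ge0_adde_def ?inE ?measure_ge0//; apply: leeD.
  apply: le_trans (gaussian_tilt_le (c := 0) mA _) _.
    move=> X; rewrite /= in_itv /= innerZl mulNr oppr_le0 => /andP[h _].
    exact: mulr_ge0.
  by rewrite ss sub0r.
apply: le_trans (gaussian_tilt_le (c := - (t * delta)) mB _) _.
  move=> X; rewrite /= in_itv /= andbT innerZl mulNr lerN2 => h.
  exact: ler_wpM2l.
rewrite ss expRD mulrC -EFinM -[leRHS]mule1.
apply: lee_wpmul2l; first by rewrite lee_fin mulr_ge0// expR_ge0.
exact: probability_le1.
Qed.

(** The slab of width 0 is empty, so [delta = 0] in the tail bound leaves the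
    exponential factor alone. *)
Lemma gaussian_chernoff v (t : R) : 0 <= t ->
  (P0 (inner v @^-1` `]-oo, (- (t * inner v v))%R]) <=
   (expR (- (t ^+ 2 * inner v v / 2)))%:E)%E.
Proof.
move=> t0.
have ss : inner (- v) (- v) = inner v v.
  by rewrite innerNl innerC innerNl opprK.
have := gaussian_tail (- v) t0 (lexx 0).
rewrite set_itvco0 preimage_set0 measure0 add0e mulr0 oppr0 expR0 mule1 ss.
rewrite (_ : inner (- v) @^-1` _ = inner v @^-1` `]-oo, (- (t * inner v v))%R])//.
apply/seteqP; split=> X /=; rewrite !in_itv /= andbT innerNl;
  by rewrite lerNr.
Qed.


(** The hyperplane is contained in slabs of arbitrarily small probability. *)
Lemma gaussian_inner_eq0 v : 0 < inner v v -> P0 (inner v @^-1` [set 0]) = 0%E.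
Proof.
move=> s0; set p := P0 _.
have mp : measurable (inner v @^-1` [set (0 : R)]) by exact: measurable_inner_preimage.
have pfin : p \is a fin_num by rewrite fin_num_measure.
apply/eqP; rewrite eq_le measure_ge0 andbT -(fineK pfin) lee_fin.
apply/ler_addgt0Pl => e e0; rewrite addr0.
set C := expR (inner v v); pose K := (Num.truncn (C / e)).+1.
have K0 : 0 < K%:R :> R by rewrite ltr0n.
have CK : C / e < K%:R by rewrite /K truncnS_gt.
have pK : (K%:R%:E * p <= C%:E)%E.
  apply: le_trans (anticoncentration v (K := K) isT).
  apply: lee_wpmul2l; first by rewrite lee_fin ltW.
  apply: le_measure; rewrite ?inE//.
    by apply: measurable_inner_preimage; exact: measurable_itv.
  by move=> X /= ->; rewrite in_itv /= lexx divr_gt0.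
move: pK; rewrite -(fineK pfin) -EFinM lee_fin => pK.
have CK' : C < K%:R * e by rewrite -ltr_pdivrMr.
by rewrite -(ler_pM2l K0) (le_trans pK)// ltW.
Qed.

Lemma gaussian_flip (s : 'M[R]_N) (A : set 'M[R]_N) :
  (forall i j, s i j ^+ 2 = 1) -> measurable A ->
  P0 A = P0 [set X | A (\matrix_(i, j) (s i j * X i j))].
Proof.
move=> s1 mA; rewrite [LHS](gaussian_matrix_signed_shift 0 s1 mA).
congr (P0 _); apply/funext => X; rewrite /preimage /=; congr A.
by apply/matrixP => i j; rewrite !mxE addr0.
Qed.

(** Changing the sign of the whole matrix exchanges the two open half-spaces,
    which together have full measure. *)
Lemma gaussian_inner_lt0 v : 0 < inner v v ->
  P0 (inner v @^-1` `]-oo, 0%R[) = (1 / 2)%:E.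
Proof.
move=> s0; set A := inner v @^-1` _; pose B := inner v @^-1` `]0%R, +oo[.
have mA : measurable A by apply: measurable_inner_preimage; exact: measurable_itv.
have mB : measurable B by apply: measurable_inner_preimage; exact: measurable_itv.
have mC : measurable (inner v @^-1` [set (0 : R)]) by exact: measurable_inner_preimage.
have AB : P0 A = P0 B.
  rewrite (gaussian_flip (s := const_mx (-1)))//; last first.
    by move=> i j; rewrite mxE sqrrN expr1n.
  congr (P0 _); apply/funext => X; rewrite /A /B /preimage /= !in_itv /= andbT.
  rewrite (_ : \matrix_(i, j) _ = (- 1) *: X); last first.
    by apply/matrixP => i j; rewrite !mxE.
  by rewrite innerZr mulN1r oppr_lt0.
have : P0 setT = (P0 A + P0 B)%E.
  rewrite (_ : setT = (A `|` B) `|` inner v @^-1` [set (0 : R)]); last first.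
    apply/seteqP; split=> // X _; rewrite /A /B /= !in_itv /= andbT.
    by case: (ltgtP (inner v X) 0) => h; [left; left|left; right|right].
  rewrite measureU//; last 2 first.
  - exact: measurableU.
  - apply/seteqP; split=> // X [] []; rewrite /A /B /= in_itv /= ?andbT => /[swap] ->;
      by rewrite ltxx.
  rewrite [X in (_ + X)%E = _](gaussian_inner_eq0 s0) adde0 measureU//.
  apply/seteqP; split=> // X []; rewrite /A /B /= !in_itv /= andbT => h1 h2.
  by have := lt_trans h1 h2; rewrite ltxx.
rewrite probability_setT -AB.
have : P0 A \is a fin_num by rewrite fin_num_measure.
by move=> /fineK <-; rewrite -EFinD => -[h]; congr _%:E; lra.
Qed.

(** When [v] and [w] have disjoint supports, changing the signs of the entries in
    the support of one of them reverses one linear form and fixes the other.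
    Hence the four open quadrants are equally likely; they are disjoint. *)
Lemma gaussian_orthant_le v w : (forall i j, v i j * w i j = 0) ->
  (P0 (inner v @^-1` `]-oo, 0%R[ `&` inner w @^-1` `]-oo, 0%R[) <= (1 / 4)%:E)%E.
Proof.
move=> vw.
pose neg : set R := `]-oo, 0%R[%classic; pose pos : set R := `]0%R, +oo[%classic.
have mneg : measurable neg by exact: measurable_itv.
have mpos : measurable pos by exact: measurable_itv.
pose Q (I J : set R) := inner v @^-1` I `&` inner w @^-1` J.
have mQ I J : measurable I -> measurable J -> measurable (Q I J).
  by move=> mI mJ; apply: measurableI; exact: measurable_inner_preimage.
pose sg (u : 'M[R]_N) : 'M[R]_N := \matrix_(i, j) (if u i j == 0 then 1 else -1).
have sg1 u i j : sg u i j ^+ 2 = 1.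
  by rewrite mxE; case: ifP => _; rewrite ?sqrrN expr1n.
have flip_self u X : inner u (\matrix_(i, j) (sg u i j * X i j)) = - inner u X.
  rewrite /inner -sumrN; apply: eq_bigr => i _; rewrite -sumrN; apply: eq_bigr => j _.
  by rewrite !mxE; case: eqP => [->|_]; ring.
have flip_other (u u' X : 'M[R]_N) : (forall i j, u i j * u' i j = 0) ->
    inner u (\matrix_(i, j) (sg u' i j * X i j)) = inner u X.
  move=> uu'; apply: eq_bigr => i _; apply: eq_bigr => j _.
  rewrite !mxE; case: eqP => [_|/eqP h]; first by rewrite mul1r.
  by have /eqP := uu' i j; rewrite mulf_eq0 (negbTE h) orbF => /eqP ->; rewrite !mul0r.
have wv i j : w i j * v i j = 0 by rewrite mulrC.
have e1 : P0 (Q neg neg) = P0 (Q pos neg).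
  rewrite (gaussian_flip (sg1 v)); last exact: mQ.
  congr (P0 _); apply/funext => X; rewrite /Q /preimage /setI /=.
  by rewrite flip_self flip_other// /neg /pos /= !in_itv /= andbT oppr_lt0.
have e2 : P0 (Q neg neg) = P0 (Q neg pos).
  rewrite (gaussian_flip (sg1 w)); last exact: mQ.
  congr (P0 _); apply/funext => X; rewrite /Q /preimage /setI /=.
  by rewrite flip_self flip_other// /neg /pos /= !in_itv /= andbT oppr_lt0.
have e3 : P0 (Q pos neg) = P0 (Q pos pos).
  rewrite (gaussian_flip (sg1 w)); last exact: mQ.
  congr (P0 _); apply/funext => X; rewrite /Q /preimage /setI /=.
  by rewrite flip_self flip_other// /neg /pos /= !in_itv /= !andbT oppr_lt0.
have np : neg `&` pos = set0.
  apply/seteqP; split=> // x []; rewrite /neg /pos /= !in_itv /= andbT => h1 h2.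
  by have := lt_trans h1 h2; rewrite ltxx.
have : (P0 ((Q neg neg `|` Q neg pos) `|` (Q pos neg `|` Q pos pos)) <= 1)%E.
  by apply: probability_le1; do 2 apply: measurableU; exact: mQ.
have QI I J I' J' : Q I J `&` Q I' J' = Q (I `&` I') (J `&` J').
  by rewrite /Q setIACA.
have Q0l J : Q set0 J = set0 by rewrite /Q preimage_set0 set0I.
have Q0r I : Q I set0 = set0 by rewrite /Q preimage_set0 setI0.
rewrite measureU//; last 3 first.
- by apply: measurableU; exact: mQ.
- by apply: measurableU; exact: mQ.
- by rewrite setIUl !setIUr !QI np !Q0l !setU0.
rewrite !measureU//; try exact: mQ; try by rewrite QI np Q0r.
move=> tot.
have : (P0 (Q neg neg) + P0 (Q neg pos) + (P0 (Q pos neg) + P0 (Q pos pos)) <= 1)%E.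
  exact: tot.
rewrite -e3 -e1 -e2.
have : P0 (Q neg neg) \is a fin_num by rewrite fin_num_measure//; exact: mQ.
rewrite -/(Q neg neg) => /fineK <-; rewrite -!EFinD !lee_fin; lra.
Qed.

End half_spaces.

(** * Counting blocks and their overlaps *)

Section counting.
Local Open Scope nat_scope.
Implicit Types n N r : nat.

Lemma leq_bin_exp N n : 'C(N, n) <= N ^ n.
Proof.
apply: leq_trans (_ : N ^_ n <= _).
  by rewrite -bin_ffact leq_pmulr// fact_gt0.
rewrite ffact_prod -[X in _ ^ X]card_ord -prod_nat_const.
by apply: leq_prod => i _; exact: leq_subr.
Qed.

(** Each of the [n] factors [N - i] of the falling factorial is at least
    [N / 2]. *)
Lemma leq_exp_bin N n : n.*2 <= N -> N ^ n <= 2 ^ n * n`! * 'C(N, n).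
Proof.
move=> nN; rewrite -mulnA (mulnC n`!) bin_ffact ffact_prod.
rewrite -[X in _ ^ X](card_ord n) -prod_nat_const.
rewrite -[X in 2 ^ X](card_ord n) -prod_nat_const -big_split /=.
apply: leq_prod => i _; rewrite mul2n doubleB leq_subRL; last first.
  rewrite leq_double (leq_trans (ltnW (ltn_ord i)))//.
  by rewrite (leq_trans _ nN)// -addnn leq_addr.
rewrite -[X in _ <= X]addnn leq_add2r.
by rewrite (leq_trans _ nN)// leq_double ltnW.
Qed.

(** Such a [B] is determined by its trace on [A] and by its [n - r] elements
    outside [A]. *)
Lemma card_overlap N n r (A : {set 'I_N}) : #|A| = n ->
  #|[set B : {set 'I_N} | (#|B| == n) && (#|A :&: B| == r)]%SET| <= 2 ^ n * N ^ (n - r).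
Proof.
move=> An; pose f (B : {set 'I_N}) := (A :&: B, B :\: A).
have f_inj : injective f.
  move=> B B' [e1 e2].
  rewrite -(finset.setID B A) -(finset.setID B' A).
  by rewrite finset.setIC e1 e2 (finset.setIC B').
rewrite -(card_imset _ f_inj).
apply: (@leq_trans #|finset.setX (powerset A) [set D : {set 'I_N} | #|D| == n - r]|).
  apply: subset_leq_card; apply/fintype.subsetP => _ /imsetP[B + ->].
  rewrite !inE => /andP[/eqP Bn /eqP ABr] /=.
  by rewrite finset.subsetIl/= cardsD Bn finset.setIC ABr.
rewrite cardsX card_powerset An card_draws card_ord leq_mul2l.
by rewrite leq_bin_exp orbT.
Qed.

End counting.

Section blocks.
Context {R : realType} (n N : nat).
Implicit Types b : {set 'I_N} * {set 'I_N}.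

Definition blocks : {set {set 'I_N} * {set 'I_N}} :=
  [set b : {set 'I_N} * {set 'I_N} | (#|b.1| == n) && (#|b.2| == n)]%SET.

Definition block_indicator b : 'M[R]_N :=
  \matrix_(i, j) ((i \in b.1) && (j \in b.2))%:R.

Definition overlap b b' : nat := #|b.1 :&: b'.1|%SET * #|b.2 :&: b'.2|%SET.

Lemma inner_block b X :
  inner (block_indicator b) X = \sum_(i in b.1) \sum_(j in b.2) X i j.
Proof.
rewrite /inner [RHS]big_mkcond; apply: eq_bigr => i _.
case: ifP => ib; last by rewrite big1// => j _; rewrite mxE ib mul0r.
rewrite [RHS]big_mkcond; apply: eq_bigr => j _.
by rewrite mxE ib /=; case: ifP; rewrite ?mul1r ?mul0r.
Qed.

Lemma inner_blocks b b' :
  inner (block_indicator b) (block_indicator b') = (overlap b b')%:R.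
Proof.
have cardE (A : {set 'I_N}) : #|A|%:R = \sum_i (i \in A)%:R :> R.
  by rewrite -sum1_card natr_sum big_mkcond; apply: eq_bigr => i _; case: ifP.
rewrite /overlap natrM !cardE big_distrlr; apply: eq_bigr => i _.
apply: eq_bigr => j _; rewrite !mxE !inE.
by do 4 case: (_ \in _); rewrite /= ?mulr0 ?mulr1.
Qed.

Lemma card_blocks : #|blocks| = ('C(N, n) ^ 2)%N.
Proof.
rewrite (_ : blocks = finset.setX [set D : {set 'I_N} | #|D| == n]%SET
                            [set D : {set 'I_N} | #|D| == n]%SET); last first.
  by apply/setP => b; rewrite !inE.
by rewrite cardsX !card_draws !card_ord.
Qed.

(** The value of [Q] depends only on the numbers of common rows and common
    columns, and for each pair of numbers the rows and the columns are counted
    separately. *)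
Lemma sum_overlap b (Q : nat -> nat -> R) : b \in blocks ->
  (forall r c, 0 <= Q r c) ->
  \sum_(b' in blocks) Q #|b.1 :&: b'.1|%SET #|b.2 :&: b'.2|%SET <=
  \sum_(r < n.+1) \sum_(c < n.+1)
    (2 ^ n * N ^ (n - r))%:R * (2 ^ n * N ^ (n - c))%:R * Q r c.
Proof.
rewrite inE => /andP[/eqP b1 /eqP b2] Q0.
have le1 (A B : {set 'I_N}) : #|A| = n -> (#|A :&: B|%SET < n.+1)%N.
  by move=> <-; rewrite ltnS subset_leq_card// finset.subsetIl.
pose p (b' : {set 'I_N} * {set 'I_N}) : 'I_n.+1 * 'I_n.+1 :=
  (Ordinal (le1 b.1 b'.1 b1), Ordinal (le1 b.2 b'.2 b2)).
rewrite (partition_big p predT)//= pair_big /=; apply: ler_sum => -[r c] _ /=.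
rewrite (eq_bigr (fun=> Q r c)); last first.
  by move=> b' /andP[_ /eqP [<- <-]].
pose S k (A : {set 'I_N}) :=
  [set B : {set 'I_N} | (#|B| == n) && (#|A :&: B| == k)]%SET.
rewrite sumr_const -[leLHS]mulr_natl ler_wpM2r// -natrM ler_nat.
apply: (@leq_trans #|finset.setX (S r b.1) (S c b.2)|).
  apply: subset_leq_card; apply/fintype.subsetP => b'.
  rewrite unfold_in inE => /andP[/andP[b'1 b'2] /eqP[<- <-]].
  by rewrite !inE b'1 b'2 !eqxx.
by rewrite cardsX; apply: leq_mul; exact: card_overlap.
Qed.

End blocks.

(** * The scan test *)

Lemma measure_bigsetU_le d (T : measurableType d) (R : realType)
    (mu : {measure set T -> \bar R}) (I : Type) (s : seq I) (P : pred I)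
    (F : I -> set T) : (forall i, measurable (F i)) ->
  (mu (\big[setU/set0]_(i <- s | P i) F i) <= \sum_(i <- s | P i) mu (F i))%E.
Proof.
move=> mF; elim: s => [|i s IH]; first by rewrite !big_nil measure0.
rewrite !big_cons; case: ifP => // _.
apply: le_trans (measureU2 _ _ _) _ => //; first exact: bigsetU_measurable.
exact: leeD2l.
Qed.

Section risk_upper.
Context {R : realType} (n N : nat).
Local Notation P0 := (gaussian_matrix_prob (0 : 'M[R]_N)).

Lemma Theta_block (A : R) (theta : 'M[R]_N) : Theta A n N theta ->
  exists2 b, b \in blocks n N & A * (n ^ 2)%:R <= inner (block_indicator b) theta.
Proof.
move=> [Rw [Cl [Rn Cn le_A _]]]; exists (Rw, Cl); first by rewrite inE Rn Cn !eqxx.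
have -> : A * (n ^ 2)%:R = \sum_(i in Rw) \sum_(j in Cl) A.
  by rewrite !sumr_const Rn Cn -mulrnA mulnn mulr_natr.
rewrite inner_block /=; apply: ler_sum => i iR; apply: ler_sum => j jC.
exact: le_A.
Qed.

(** The risk of the test that rejects when some block sum reaches
    [A * (n ^ 2)]. *)
Lemma minimax_risk_le (A : R) : (0 < n)%N ->
  (minimax_risk n N A <= (1 / 2)%:E +
   \sum_(b in blocks n N)
     P0 (inner (block_indicator b) @^-1` `[(A * (n ^ 2)%:R)%R, +oo[))%E.
Proof.
move=> n0; set F := fun b =>
  inner (block_indicator b) @^-1` `[(A * (n ^ 2)%:R)%R, +oo[%classic : set 'M[R]_N.
have mF b : measurable (F b).
  by apply: measurable_inner_preimage; exact: measurable_itv.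
pose T (X : 'M[R]_N) : bool :=
  [exists b in blocks n N, A * (n ^ 2)%:R <= inner (block_indicator b) X].
have TE : [set X | T X = true] = \big[setU/set0]_(b in blocks n N) F b.
  apply/seteqP; split=> X /=.
    move=> /existsP[b /andP[bB h]]; rewrite (bigD1 b)//=; left.
    by rewrite /F /= in_itv /= andbT.
  elim/big_ind: _ => // [B C IB IC []//|b bB].
  rewrite /F /= in_itv /= andbT => h; apply/existsP; exists b.
  by rewrite bB.
have mT : measurable_fun setT T.
  apply: (@measurable_fun_bool _ _ _ _ true); rewrite setTI.
  rewrite (_ : _ @^-1` _ = [set X | T X = true]) ?TE//.
  exact: bigsetU_measurable.
apply: le_trans (ereal_inf_lbound _) _; first by exists T; [exact: mT|reflexivity].
rewrite addeC; apply: leeD.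
  apply: ge_ereal_sup => _ [theta th <-].
  have [b bB hb] := Theta_block th.
  have mC : measurable
      (inner (block_indicator b : 'M[R]_N) @^-1` `]-oo, (A * (n ^ 2)%:R)%R[).
    by apply: measurable_inner_preimage; exact: measurable_itv.
  have s0 : 0 < inner (block_indicator b : 'M[R]_N) (block_indicator b).
    rewrite inner_blocks ltr0n /overlap !finset.setIid.
    by move: bB; rewrite inE => /andP[/eqP -> /eqP ->]; rewrite muln_gt0 n0.
  rewrite -(gaussian_inner_lt0 s0).
  apply: (@le_trans _ _ (gaussian_matrix_prob theta
      (inner (block_indicator b) @^-1` `]-oo, (A * (n ^ 2)%:R)%R[))).
    apply: le_measure; rewrite ?inE//.
      by rewrite -[X in measurable X]setTI; exact: (mT measurableT [set false]).
    move=> X /=; rewrite in_itv /= ltNge => /negbT; apply: contra => h.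
    by apply/existsP; exists b; rewrite bB.
  rewrite [leLHS](gaussian_shift_inner (block_indicator b) theta); last exact: measurable_itv.
  apply: le_measure; rewrite ?inE.
  - have := measurable_inner_preimage (block_indicator b)
      (measurable_itv `]-oo, (A * (n ^ 2)%:R - inner (block_indicator b) theta)[).
    congr measurable; apply/seteqP; split=> X /=; rewrite !in_itv /=; lra.
  - by apply: measurable_inner_preimage; exact: measurable_itv.
  - by move=> X /=; rewrite !in_itv /=; lra.
by rewrite [X in P0 X]TE; exact: measure_bigsetU_le.
Qed.

End risk_upper.


(** * Truncated likelihood ratios *)

(** The value of the right-hand side is the integral of 1 outside [B] and of [u]
    inside, so at least that of [min 1 u]; and
    [min 1 u >= 3 u / 2 - u ^ 2 / 2 - 1 / 8], because the differences are
    [(u - 3 / 2) ^ 2 / 2] and [(u - 1 / 2) ^ 2 / 2]. For [q = 1 / 4], that is for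
    [u] almost constant, the bound is 1/2. *)
Lemma truncated_second_moment d (T : measurableType d) (R : realType)
    (P : probability T R) (u : T -> R) (B : set T) (q : R) :
  measurable B -> measurable_fun setT u -> (forall x, 0 <= u x) ->
  (\int[P]_x (u x)%:E = (1 / 2)%:E)%E ->
  (\int[P]_x (u x ^+ 2)%:E <= q%:E)%E ->
  ((5 / 8 - q / 2)%:E <= P (~` B) + \int[P]_(x in B) (u x)%:E)%E.
Proof.
move=> mB mu u0 u1 u2.
have muE : measurable_fun setT (EFin \o u) by exact/measurable_EFinP.
have mu2 : measurable_fun setT (fun x => (u x ^+ 2)%:E).
  by apply/measurable_EFinP; exact: measurable_funX.
pose h1 x : \bar R := (\1_(~` B) x)%:E.
pose h2 x : \bar R := (\1_B x * u x)%:E.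
pose h3 x : \bar R := ((1 / 2)%:E * (u x ^+ 2)%:E)%E.
have m1 : measurable_fun setT h1.
  by apply/measurable_EFinP; apply: measurable_indic; exact: measurableC.
have m2 : measurable_fun setT h2.
  by apply/measurable_EFinP; apply: measurable_funM => //; exact: measurable_indic.
have m3 : measurable_fun setT h3 by exact: measurable_funeM.
have h1_0 x : (0 <= h1 x)%E by rewrite lee_fin.
have h2_0 x : (0 <= h2 x)%E by rewrite lee_fin mulr_ge0.
have h3_0 x : (0 <= h3 x)%E by rewrite mule_ge0// lee_fin// sqr_ge0.
have c0 : 0 <= 1 / 8 :> R by lra.
have key : ((3 / 4)%:E <= \int[P]_x (h1 x + h2 x + h3 x + (1 / 8)%:E))%E.
  have -> : (3 / 4)%:E = (\int[P]_x ((3 / 2)%:E * (u x)%:E))%E.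
    rewrite ge0_integralZl//; last by move=> x _; rewrite lee_fin.
    by rewrite u1 -EFinM; congr _%:E; field.
  apply: ge0_le_integral => //.
  - by move=> x _; rewrite -EFinM lee_fin; have := u0 x; lra.
  - exact: measurable_funeM.
  - by apply: emeasurable_funD => //; do 2 apply: emeasurable_funD => //.
  - move=> x _; rewrite /h1 /h2 /h3 -!EFinM -!EFinD lee_fin !indicE in_setC.
    have := sqr_ge0 (u x - 1 / 2); have := sqr_ge0 (u x - 3 / 2).
    case: (x \in B); rewrite /= ?mulr1n ?mulr0n; nra.
move: key; rewrite ge0_integralD//; last 2 first.
- by move=> x _; rewrite !adde_ge0.
- by do 2 apply: emeasurable_funD => //.
rewrite ge0_integralD//; last 2 first.
- by move=> x _; rewrite adde_ge0.
- exact: emeasurable_funD.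
rewrite ge0_integralD// integral_indic ?setIT//; last exact: measurableC.
have -> : (\int[P]_x (1 / 8)%:E = (1 / 8)%:E)%E.
  rewrite integral_cst//.
  by rewrite -[RHS]mule1; congr (_ * _)%E; exact: (probability_setT P).
have -> : (\int[P]_x h2 x = \int[P]_(x in B) (u x)%:E)%E.
  rewrite [RHS]integral_mkcond; apply: eq_integral => x _.
  by rewrite patchE /h2 indicE; case: (x \in B); rewrite ?mul1r ?mul0r.
have h3q : (\int[P]_x h3 x <= (q / 2)%:E)%E.
  rewrite ge0_integralZl//; last by move=> x _; rewrite lee_fin sqr_ge0.
  have -> : (q / 2)%:E = ((1 / 2)%:E * q%:E)%E by rewrite -EFinM; congr _%:E; field.
  by apply: lee_wpmul2l => //; rewrite lee_fin; lra.
move=> key.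
have : ((3 / 4)%:E <= (P (~` B) + \int[P]_(x in B) (u x)%:E) + (q / 2)%:E + (1 / 8)%:E)%E.
  by apply: le_trans key _; apply: leeD => //; apply: leeD.
rewrite -addeA -EFinD -leeBlDr// -EFinB.
by congr (_ <= _)%E; congr _%:E; field.
Qed.

Section truncated_likelihood.
Context {R : realType} (N : nat).
Implicit Types (theta : 'M[R]_N) (E : set 'M[R]_N).
Local Notation P0 := (gaussian_matrix_prob (0 : 'M[R]_N)).

Definition truncated_likelihood theta E (X : 'M[R]_N) : R :=
  \1_E X * expR (inner theta X - inner theta theta / 2).

Lemma truncated_likelihood_ge0 theta E X : 0 <= truncated_likelihood theta E X.
Proof. by rewrite mulr_ge0// expR_ge0. Qed.

Lemma measurable_truncated_likelihood theta E : measurable E ->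
  measurable_fun setT (truncated_likelihood theta E).
Proof.
move=> mE; apply: measurable_funM; first exact: measurable_indic.
apply: (measurableT_comp (@measurable_expR R)).
by apply: measurable_funB => //; exact: measurable_inner.
Qed.

Lemma integral_truncated_likelihood theta E B : measurable E -> measurable B ->
  (\int[P0]_(X in B) (truncated_likelihood theta E X)%:E =
   gaussian_matrix_prob theta (B `&` E))%E.
Proof.
move=> mE mB; rewrite gaussian_matrix_tilt; last exact: measurableI.
rewrite integral_mkcondr; apply: eq_integral => X _.
by rewrite patchE /truncated_likelihood indicE; case: (X \in E);
  rewrite ?mul1r ?mul0r.
Qed.

(** The product of the densities of [P_theta] and [P_theta'] is the density of
    [P_(theta + theta')] up to the constant [exp <theta, theta'>]. *)
Lemma integral_truncated_likelihoodM theta theta' E E' :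
  measurable E -> measurable E' ->
  (\int[P0]_X (truncated_likelihood theta E X * truncated_likelihood theta' E' X)%:E =
   (expR (inner theta theta'))%:E * gaussian_matrix_prob (theta + theta') (E `&` E'))%E.
Proof.
move=> mE mE'.
have mEE' : measurable (E `&` E') by exact: measurableI.
rewrite -[in RHS](setTI (E `&` E')) -integral_truncated_likelihood//.
rewrite -ge0_integralZl//; first last.
- by move=> X _; rewrite lee_fin truncated_likelihood_ge0.
- by apply/measurable_EFinP; exact: measurable_truncated_likelihood.
apply: eq_integral => X _; rewrite -EFinM /truncated_likelihood indicI.
rewrite /= !innerDl !innerDr (innerC theta' theta); congr _%:E.
transitivity ((\1_E X * \1_E' X) *
  expR (inner theta X - inner theta theta / 2 + (inner theta' X - inner theta' theta' / 2))).
  by rewrite [X in _ = _ * X]expRD mulrACA.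
rewrite mulrCA -expRD; congr (_ * expR _).
by field.
Qed.

(** A test with acceptance region [B] has a worst-case error of the second kind
    at least the average of [P_theta_b (B)], hence of [P_theta_b (B `&` E_b)],
    over the family. Apply the second moment bound to the average [u] of the
    truncated likelihood ratios. *)
Lemma minimax_risk_ge (n : nat) (A : R) (I : finType) (S : {set I})
    (theta : I -> 'M[R]_N) (E : I -> set 'M[R]_N) (q : R) :
  (0 < #|S|)%N ->
  (forall b, b \in S -> Theta A n N (theta b)) ->
  (forall b, measurable (E b)) ->
  (forall b, b \in S -> gaussian_matrix_prob (theta b) (E b) = (1 / 2)%:E) ->
  (\sum_(b in S) \sum_(b' in S) (expR (inner (theta b) (theta b')))%:E *
      gaussian_matrix_prob (theta b + theta b') (E b `&` E b')
    <= (#|S|%:R ^+ 2 * q)%:E)%E ->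
  ((5 / 8 - q / 2)%:E <= minimax_risk n N A)%E.
Proof.
move=> S0 thS mE half pairs.
set M : R := #|S|%:R; have M0 : 0 < M by rewrite ltr0n.
apply: le_ereal_inf_tmp => _ [T mT <-].
set B := [set X : 'M[R]_N | T X = false].
have mB : measurable B.
  by rewrite -[X in measurable X]setTI; exact: (mT measurableT [set false]).
have -> : [set X | T X = true] = ~` B.
  by apply/seteqP; split=> X /=; rewrite /B /=; case: (T X).
pose f b X := truncated_likelihood (theta b) (E b) X.
have f0 b X : 0 <= f b X by exact: truncated_likelihood_ge0.
have mf b D : measurable_fun D (fun X => (f b X)%:E).
  apply: measurable_funTS; apply/measurable_EFinP.
  exact: measurable_truncated_likelihood.
pose u X : R := M^-1 * \sum_(b in S) f b X.
have mu : measurable_fun setT u.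
  apply: measurable_funM => //.
  rewrite (_ : (fun X => _) = fun X => \sum_b if b \in S then f b X else 0).
    apply: measurable_sum => b; case: (b \in S) => //.
    exact: measurable_truncated_likelihood.
  by apply/funext => X; rewrite big_mkcond.
have u0 X : 0 <= u X.
  by apply: mulr_ge0; [rewrite invr_ge0 ltW | apply: sumr_ge0].
have int_u D : measurable D ->
    (\int[P0]_(X in D) (u X)%:E =
     M^-1%:E * \sum_(b in S) gaussian_matrix_prob (theta b) (D `&` E b))%E.
  move=> mD; under eq_integral do rewrite EFinM -sumEFin.
  rewrite ge0_integralZl//; first last.
  - by rewrite lee_fin invr_ge0 ltW.
  - by move=> X _; apply: sume_ge0 => b _; rewrite lee_fin.
  - under eq_fun do rewrite big_mkcond /=.
    by apply: emeasurable_sum => b; case: (b \in S).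
  congr (_ * _)%E; under eq_integral do rewrite big_mkcond /=.
  rewrite ge0_integral_sum//; first last.
  - by move=> b X _; case: ifP; rewrite ?lee_fin.
  - by move=> b; case: (b \in S).
  rewrite [RHS]big_mkcond; apply: eq_bigr => b _; case: ifP => bS.
    exact: integral_truncated_likelihood.
  by rewrite integral0.
have := truncated_second_moment (q := q) mB mu u0.
move=> /(_ P0) H; apply: le_trans (H _ _) _ => {H}.
- rewrite int_u//; under eq_bigr => b bS do rewrite setTI half//.
  rewrite sumEFin sumr_const -EFinM; congr _%:E.
  by rewrite -/M -[X in _ * X]mulr_natl -/M mulrA mulVf ?mul1r// gt_eqF.
- have -> : (\int[P0]_X (u X ^+ 2)%:E = (M^-1 ^+ 2)%:E *
    \sum_(b in S) \sum_(b' in S) (expR (inner (theta b) (theta b')))%:E *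
      gaussian_matrix_prob (theta b + theta b') (E b `&` E b'))%E.
    transitivity (\int[P0]_X ((M^-1 ^+ 2)%:E *
        \sum_(p in finset.setX S S) (f p.1 X * f p.2 X)%:E))%E.
      apply: eq_integral => X _; rewrite sumEFin -EFinM /u exprMn; congr (_ * _)%:E.
      rewrite expr2 big_distrlr pair_big /=.
      by apply: eq_bigl => -[b b']; rewrite inE.
    rewrite ge0_integralZl//; first last.
    + by rewrite lee_fin sqr_ge0.
    + by move=> X _; apply: sume_ge0 => p _; rewrite lee_fin mulr_ge0.
    + under eq_fun do rewrite big_mkcond /=.
      apply: emeasurable_sum => p; case: (p \in _) => //.
      by under eq_fun do rewrite EFinM; apply: emeasurable_funM.
    congr (_ * _)%E; under eq_integral do rewrite big_mkcond /=.
    rewrite ge0_integral_sum//; first last.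
    + by move=> p X _; case: ifP; rewrite ?lee_fin ?mulr_ge0.
    + move=> p; case: (p \in _) => //.
      by under eq_fun do rewrite EFinM; apply: emeasurable_funM.
    rewrite pair_big big_mkcond [RHS]big_mkcond; apply: eq_bigr => -[b b'] _ /=.
    rewrite !inE /=; case: ifP => _; last by rewrite integral0.
    exact: integral_truncated_likelihoodM.
  apply: (@le_trans _ _ ((M^-1 ^+ 2)%:E * (M ^+ 2 * q)%:E)%E).
    by apply: lee_wpmul2l => //; rewrite lee_fin sqr_ge0.
  by rewrite -EFinM mulrA -exprMn mulVf ?expr1n ?mul1r// gt_eqF.
apply: leeD2l; rewrite int_u//.
set s := ereal_sup _.
have sub b : b \in S -> (gaussian_matrix_prob (theta b) (B `&` E b) <= s)%E.
  move=> bS; apply: (@le_trans _ _ (gaussian_matrix_prob (theta b) B)).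
    by apply: le_measure; rewrite ?inE//; exact: measurableI.
  by apply: ereal_sup_ubound; exists (theta b) => //; exact: thS.
have [b0 b0S] : exists b, b \in S by apply/card_gt0P.
have s_fin : s \is a fin_num.
  rewrite ge0_fin_numE.
    apply: (@le_lt_trans _ _ 1%E); last exact: ltry.
    by apply: ge_ereal_sup => _ [t _ <-]; exact: probability_le1.
  by apply: le_trans (sub b0 b0S).
apply: (@le_trans _ _ (M^-1%:E * \sum_(b in S) s)%E).
  apply: lee_wpmul2l; first by rewrite lee_fin invr_ge0 ltW.
  exact: lee_sum.
rewrite -(fineK s_fin) sumEFin sumr_const -EFinM lee_fin.
by rewrite -[X in _ * X]mulr_natl -/M mulrA mulVf ?mul1r// gt_eqF.
Qed.

End truncated_likelihood.

(** * Moments over pairs of blocks *)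

(** A bound for the quotient of the Gaussian tail at [t s] by
    [exp (- t ^ 2 s / 2)], for a linear form of variance [s]: it is small for
    large [K] and [t] much larger than [K]. *)
Definition tail_factor {R : realType} (K : nat) (s t : R) : R :=
  expR s / K%:R + expR (- (t * (s / K%:R))).

(** A bound for the excess over 1/4 of the mixed moment of two truncated
    likelihood ratios whose blocks share [r] rows and [c] columns: nothing for disjoint
    blocks, the sharp tail for equal ones, and the Chernoff bound otherwise. *)
Definition pair_bound {R : realType} (n K : nat) (A : R) (r c : nat) : R :=
  if (r * c == 0)%N then 0 else
  if (r == n) && (c == n) then
    expR (A ^+ 2 * (n ^ 2)%:R / 2) * tail_factor K (n ^ 2)%:R A
  else expR (A ^+ 2 * ((r * c)%:R * (n ^ 2)%:R / ((n ^ 2)%:R + (r * c)%:R))).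

Lemma pair_bound_ge0 {R : realType} n K (A : R) r c : 0 <= pair_bound n K A r c.
Proof.
rewrite /pair_bound; case: ifP => // _; case: ifP => _; last exact: expR_ge0.
by rewrite mulr_ge0 ?expR_ge0// addr_ge0 ?expR_ge0// divr_ge0 ?expR_ge0.
Qed.

Section pairs_of_blocks.
Context {R : realType} (n N : nat).
Implicit Types (A : R).
Local Notation P0 := (gaussian_matrix_prob (0 : 'M[R]_N)).
Local Notation "'v_ b" := (block_indicator b : 'M[R]_N) (at level 8, b at level 2).

(** The tail bound with slab width [|v| ^ 2 / K], where anticoncentration bounds
    the probability of the slab. *)
Lemma sharp_tail (v : 'M[R]_N) (t : R) (K : nat) : 0 <= t -> (0 < K)%N ->
  (P0 (inner v @^-1` `[(t * inner v v)%R, +oo[) <=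
   (expR (- (t ^+ 2 * inner v v / 2)) * tail_factor K (inner v v) t)%:E)%E.
Proof.
move=> t0 K0; set s := inner v v; have s0 : 0 <= s by exact: inner_ge0.
have K0' : 0 < K%:R :> R by rewrite ltr0n.
have d0 : 0 <= s / K%:R by rewrite divr_ge0// ltW.
apply: le_trans (gaussian_tail v t0 d0) _.
rewrite -/s EFinM; apply: lee_wpmul2l; first by rewrite lee_fin expR_ge0.
rewrite /tail_factor EFinD; apply: leeD2r.
have := anticoncentration v K0; rewrite -/s.
have : P0 (inner v @^-1` `[0%R, (s / K%:R)%R[) \is a fin_num.
  by rewrite fin_num_measure//; apply: measurable_inner_preimage; exact: measurable_itv.
by move=> /fineK <-; rewrite -EFinM !lee_fin ler_pdivlMr// mulrC.
Qed.

Lemma inner_block_self b : b \in blocks n N -> inner 'v_b 'v_b = (n ^ 2)%:R.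
Proof.
rewrite inE => /andP[/eqP b1 /eqP b2].
by rewrite inner_blocks /overlap !finset.setIid b1 b2 mulnn.
Qed.

Lemma block_in_Theta A b : b \in blocks n N -> Theta A n N (A *: 'v_b).
Proof.
rewrite inE => /andP[/eqP b1 /eqP b2]; exists b.1, b.2; split => // i j.
  by move=> ib jb; rewrite !mxE ib jb mulr1.
by move=> /negbTE ijb; rewrite !mxE ijb mulr0.
Qed.

Definition below A (b : {set 'I_N} * {set 'I_N}) : set 'M[R]_N :=
  inner 'v_b @^-1` `]-oo, (A * (n ^ 2)%:R)%R[.

Lemma measurable_below A b : measurable (below A b).
Proof. by apply: measurable_inner_preimage; exact: measurable_itv. Qed.

(** Under the signal on [b] the block sum is centred at the truncation level. *)
Lemma gaussian_below A b : (0 < n)%N -> b \in blocks n N ->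
  gaussian_matrix_prob (A *: 'v_b) (below A b) = (1 / 2)%:E.
Proof.
move=> n0 bB; have s0 : 0 < inner 'v_b 'v_b.
  by rewrite inner_block_self// ltr0n expn_gt0 n0.
rewrite [LHS](gaussian_shift_inner 'v_b (A *: 'v_b)); last exact: measurable_itv.
rewrite -(gaussian_inner_lt0 s0); congr (P0 _).
apply/funext => X; rewrite /preimage /= !in_itv /= innerZr inner_block_self//.
by rewrite gtrDr.
Qed.

(** With [k] common entries, the shift by [A 1_b + A 1_b'] makes both truncation
    events the requirement that a block sum be below [- A k]. For [k = 0] this
    is a quadrant; for [b = b'] the sharp tail
    applies; in general the form [<1_b + 1_b', X>], of variance
    [2 (n ^ 2 + k)], is at most [- 2 A k]. *)
Lemma pair_of_blocks_le A K b b' : 0 <= A -> (0 < n)%N -> (0 < K)%N ->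
  b \in blocks n N -> b' \in blocks n N ->
  ((expR (inner (A *: 'v_b) (A *: 'v_b')))%:E *
     gaussian_matrix_prob (A *: 'v_b + A *: 'v_b') (below A b `&` below A b') <=
   (1 / 4 + pair_bound n K A #|b.1 :&: b'.1|%SET #|b.2 :&: b'.2|%SET)%:E)%E.
Proof.
move=> A0 n0 K0 bB b'B; set k : R := (overlap b b')%:R.
have k0 : 0 <= k by rewrite ler0n.
have n20 : 0 < (n ^ 2)%:R :> R by rewrite ltr0n expn_gt0 n0.
have ik : inner 'v_b 'v_b' = k by exact: inner_blocks.
pose low b : set 'M[R]_N := inner 'v_b @^-1` `]-oo, (- (A * k))%R[%classic.
have mlow c : measurable (low c).
  by apply: measurable_inner_preimage; exact: measurable_itv.
have -> : gaussian_matrix_prob (A *: 'v_b + A *: 'v_b') (below A b `&` below A b') =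
    P0 (low b `&` low b').
  rewrite [LHS]gaussian_matrix_shift; last by apply: measurableI; exact: measurable_below.
  congr (P0 _); apply/funext => X; rewrite /below /low /preimage /setI /=.
  rewrite !in_itv /= !innerDr !innerZr !inner_block_self// (innerC 'v_b' 'v_b) ik.
  by apply/propext; split=> -[h1 h2]; split; lra.
rewrite innerZl innerZr ik; rewrite /pair_bound -/(overlap b b').
case: eqP => [k_eq0|/eqP k_neq0].
  have -> : k = 0 by rewrite /k k_eq0.
  rewrite !mulr0 expR0 mul1e addr0 /low /k k_eq0 mulr0 oppr0.
  apply: gaussian_orthant_le => i j.
  move/eqP: k_eq0; rewrite muln_eq0 !cards_eq0 !mxE.
  case/orP=> /eqP /setP; [move=> /(_ i)|move=> /(_ j)]; rewrite !inE => /negbT;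
    rewrite negb_and => /orP[] /negbTE ->; rewrite ?andbF /= ?mul0r ?mulr0//.
have q0 : 0 <= 1 / 4 :> R by lra.
case: ifP => [/andP[/eqP e1 /eqP e2]|_].
  have kn : k = (n ^ 2)%:R by rewrite /k /overlap e1 e2 mulnn.
  have vv : inner (- 'v_b) (- 'v_b) = (n ^ 2)%:R.
    by rewrite innerNl innerC innerNl opprK inner_block_self.
  have h : (P0 (low b `&` low b') <=
      (expR (- (A ^+ 2 * (n ^ 2)%:R / 2)) * tail_factor K (n ^ 2)%:R A)%:E)%E.
    rewrite -vv; apply: le_trans (sharp_tail (- 'v_b) A0 K0).
    apply: le_measure; rewrite ?inE.
    - exact: measurableI.
    - by apply: measurable_inner_preimage; exact: measurable_itv.
    - move=> X [] + _; rewrite /low /= !in_itv /= andbT vv innerNl -kn; lra.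
  apply: le_trans (lee_wpmul2l _ h) _; first by rewrite lee_fin expR_ge0.
  rewrite -EFinM lee_fin [leLHS]mulrA -expRD kn.
  rewrite (_ : A * (A * (n ^ 2)%:R) + - (A ^+ 2 * (n ^ 2)%:R / 2) =
    A ^+ 2 * (n ^ 2)%:R / 2); last by field.
  by rewrite lerDr.
pose v := 'v_b + 'v_b'; have vv : inner v v = 2 * ((n ^ 2)%:R + k).
  rewrite /v innerDl !innerDr !inner_block_self// (innerC 'v_b' 'v_b) ik; ring.
have d0 : 0 < (n ^ 2)%:R + k by rewrite ltr_pwDl.
(* The value of [t] for which the level [2 A k] equals [t |v| ^ 2]. *)
pose t := A * k / ((n ^ 2)%:R + k).
have t0 : 0 <= t by rewrite divr_ge0 ?mulr_ge0// ltW.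
have tvv : t * inner v v = 2 * (A * k).
  by rewrite vv /t; move: (n ^ 2)%:R d0 => s d0; field; exact: lt0r_neq0.
have h : (P0 (low b `&` low b') <= (expR (- (t ^+ 2 * inner v v / 2)))%:E)%E.
  apply: le_trans (gaussian_chernoff v t0).
  apply: le_measure; rewrite ?inE.
  - exact: measurableI.
  - by apply: measurable_inner_preimage; exact: measurable_itv.
  - move=> X []; rewrite /low /= !in_itv /= tvv /v innerDl; lra.
apply: le_trans (lee_wpmul2l _ h) _; first by rewrite lee_fin expR_ge0.
rewrite -EFinM lee_fin -expRD -/(overlap b b') -/k.
rewrite (_ : _ + - _ = A ^+ 2 * (k * (n ^ 2)%:R / ((n ^ 2)%:R + k))).
  by rewrite lerDr.
by rewrite vv /t; move: (n ^ 2)%:R d0 => s d0; field; exact: lt0r_neq0.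
Qed.

Lemma minimax_risk_ge_blocks A K : 0 <= A -> (0 < n)%N -> (0 < K)%N -> (n <= N)%N ->
  ((1 / 2 - ('C(N, n)%:R ^+ 2)^-1 / 2 *
     \sum_(r < n.+1) \sum_(c < n.+1)
       (2 ^ n * N ^ (n - r))%:R * (2 ^ n * N ^ (n - c))%:R * pair_bound n K A r c)%:E
   <= minimax_risk n N A)%E.
Proof.
move=> A0 n0 K0 nN; set W := \sum_(r < _) _.
have C0 : (0 < 'C(N, n))%N by rewrite bin_gt0.
have C0' : 0 < 'C(N, n)%:R ^+ 2 :> R by rewrite exprn_gt0// ltr0n.
have cB : #|blocks n N|%:R = 'C(N, n)%:R ^+ 2 :> R by rewrite card_blocks natrX.
have -> : 1 / 2 - ('C(N, n)%:R ^+ 2)^-1 / 2 * W =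
    5 / 8 - (1 / 4 + ('C(N, n)%:R ^+ 2)^-1 * W) / 2.
  by move: ('C(N, n)%:R ^+ 2) C0' => C C0'; field; exact: lt0r_neq0.
apply: (@minimax_risk_ge _ N n A _ (blocks n N) (fun b => A *: 'v_b) (below A)).
- by rewrite card_blocks expn_gt0 C0.
- by move=> b; exact: block_in_Theta.
- by move=> b; exact: measurable_below.
- by move=> b; exact: gaussian_below.
apply: (@le_trans _ _ (\sum_(b in blocks n N) (#|blocks n N|%:R / 4 + W)%:E)%E).
  apply: lee_sum => b bB.
  apply: le_trans (lee_sum _ (fun b' b'B => pair_of_blocks_le A0 n0 K0 bB b'B)) _.
  rewrite sumEFin lee_fin big_split /= sumr_const -[X in X + _]mulr_natl div1r.
  rewrite lerD2l; apply: sum_overlap => // r c; exact: pair_bound_ge0.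
rewrite sumEFin lee_fin sumr_const -[leLHS]mulr_natl cB.
rewrite [leRHS](_ : _ = 'C(N, n)%:R ^+ 2 * ('C(N, n)%:R ^+ 2 / 4 + W))//.
by move: ('C(N, n)%:R ^+ 2) C0' => C C0'; field; exact: lt0r_neq0.
Qed.

End pairs_of_blocks.

(** * Asymptotics at the critical level *)

Section critical_level.
Context {R : realType} (n : nat).
Hypothesis n0 : (0 < n)%N.

Definition critical (N : nat) : R := Num.sqrt (4 * ln N%:R / n%:R).

Let n0' : 0 < n%:R :> R. Proof. by rewrite ltr0n. Qed.

Lemma critical_sqr N : (0 < N)%N -> critical N ^+ 2 = 4 * ln N%:R / n%:R.
Proof.
by move=> N0; rewrite sqr_sqrtr// divr_ge0// mulr_ge0// ln_ge0// ler1n.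
Qed.

Lemma near_ln_ge (C : R) : \forall N \near \oo, C <= ln (N%:R : R).
Proof.
near=> N; have N0 : 0 < N%:R :> R by rewrite ltr0n; near: N; exact: nbhs_infty_gt.
rewrite -ler_expR lnK//; near: N; exact: nbhs_infty_ger.
Unshelve. all: by end_near. Qed.

Lemma near_critical_ge (C : R) : \forall N \near \oo, C <= critical N.
Proof.
near=> N; rewrite (le_trans (ler_norm C))// -[leLHS]sqrtr_sqr ler_wsqrtr//.
rewrite ler_pdivlMr// -ler_pdivrMl//; near: N; exact: near_ln_ge.
Unshelve. all: by end_near. Qed.

Lemma near_tail_factor_le (e : R) : 0 < e -> exists2 K, (0 < K)%N &
  \forall N \near \oo, tail_factor K (n ^ 2)%:R (critical N) <= e.
Proof.
move=> e0; have e2 : 0 < e / 2 by rewrite divr_gt0.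
set s : R := (n ^ 2)%:R; have s0 : 0 < s by rewrite ltr0n expn_gt0 n0.
pose K := (Num.truncn (expR s / (e / 2))).+1; exists K => //.
have K0 : 0 < K%:R :> R by rewrite ltr0n.
have sK0 : 0 < s / K%:R by rewrite divr_gt0.
near=> N; rewrite /tail_factor [leRHS](splitr e) lerD//.
  rewrite ler_pdivrMr// mulrC -ler_pdivrMr//.
  by rewrite ltW// /K truncnS_gt.
rewrite -[leRHS]lnK// ler_expR lerNl -ler_pdivrMr//.
near: N; exact: near_critical_ge.
Unshelve. all: by end_near. Qed.

(** After clearing the denominator the gap is
    [r (n - c) ^ 2 + c (n - r) ^ 2]. *)
Lemma exponent_gap (r c : nat) : (0 < r)%N -> (0 < c)%N -> ~~ ((r == n) && (c == n)) ->
  0 < r%:R + c%:R - 4 * n%:R * (r * c)%:R / ((n ^ 2)%:R + (r * c)%:R) :> R.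
Proof.
move=> r0 c0 rcn; rewrite subr_gt0 natrM natrX.
have r0' : 0 < r%:R :> R by rewrite ltr0n.
have c0' : 0 < c%:R :> R by rewrite ltr0n.
rewrite ltr_pdivrMr; last by rewrite addr_gt0 ?exprn_gt0 ?mulr_gt0.
rewrite -subr_gt0.
rewrite [ltRHS](_ : _ = r%:R * (n%:R - c%:R) ^+ 2 + c%:R * (n%:R - r%:R) ^+ 2); last by ring.
have [rn|rn] := eqVneq r n; last first.
  apply: ltr_wpDl; first by rewrite mulr_ge0 ?sqr_ge0.
  by rewrite mulr_gt0// exprn_even_gt0//= subr_eq0 eqr_nat eq_sym.
move: rcn; rewrite rn eqxx /= => cn.
apply: ltr_pwDl; last by rewrite mulr_ge0 ?sqr_ge0.
by rewrite mulr_gt0// exprn_even_gt0//= subr_eq0 eqr_nat eq_sym.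
Qed.

(** At the critical level every exponent is a multiple of [ln N]; for [r = c = n]
    the multiples cancel and only the tail factor is left. *)
Lemma pair_bound_critical N K r c : (0 < N)%N -> (r <= n)%N -> (c <= n)%N ->
  expR (- (r%:R * ln N%:R)) * expR (- (c%:R * ln N%:R)) * pair_bound n K (critical N) r c =
  if (r * c == 0)%N then 0 else
  if (r == n) && (c == n) then tail_factor K (n ^ 2)%:R (critical N)
  else expR (- ((r%:R + c%:R - 4 * n%:R * (r * c)%:R / ((n ^ 2)%:R + (r * c)%:R))
               * ln N%:R)).
Proof.
move=> N0 rn cn; rewrite /pair_bound critical_sqr//.
case: eqP => [_|/eqP rc0]; first by rewrite mulr0.
case: ifP => [/andP[/eqP -> /eqP ->]|_].
  rewrite mulrA -!expRD -[RHS]mul1r; congr (_ * _); rewrite (_ : _ + _ = 0) ?expR0//.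
  by rewrite natrX; field; exact: lt0r_neq0.
rewrite -!expRD; congr expR.
have d0 : 0 < (n ^ 2)%:R + (r * c)%:R :> R by rewrite ltr_pwDl// ltr0n expn_gt0 n0.
move: d0; rewrite natrX; move: (r * c)%:R => k d0.
by field; rewrite !lt0r_neq0.
Qed.

Lemma near_pair_bound_le (e : R) : 0 < e -> exists2 K, (0 < K)%N &
  \forall N \near \oo, forall r c, (r <= n)%N -> (c <= n)%N ->
    expR (- (r%:R * ln N%:R)) * expR (- (c%:R * ln N%:R)) *
      pair_bound n K (critical N) r c <= e.
Proof.
move=> e0; have [K K0 HK] := near_tail_factor_le e0; exists K => //.
pose gap (r c : nat) : R :=
  r%:R + c%:R - 4 * n%:R * (r * c)%:R / ((n ^ 2)%:R + (r * c)%:R).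
(* A common threshold for [ln N], at least that of each pair [r, c]. *)
pose C := \sum_(r < n.+1) \sum_(c < n.+1) `|ln e / gap r c|.
near=> N; move=> r c rn cn.
rewrite pair_bound_critical//; last by near: N; exact: nbhs_infty_gt.
case: eqP => [_|/eqP]; first exact: ltW.
rewrite muln_eq0 negb_or -!lt0n => /andP[r0 c0].
case: ifP => [_|/negbT rcn]; first by near: N.
have g0 := exponent_gap r0 c0 rcn; rewrite -/(gap r c) in g0 *.
rewrite -[leRHS]lnK// ler_expR lerNl mulrC -ler_pdivrMr//.
apply: (@le_trans _ _ C); last by near: N; exact: near_ln_ge.
rewrite mulNr (le_trans (ler_norm _))// normrN /C.
rewrite (bigD1 (Ordinal (rn : (r < n.+1)%N)))//= (bigD1 (Ordinal (cn : (c < n.+1)%N)))//=.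
rewrite -addrA lerDl addr_ge0//; apply: sumr_ge0 => i _ //.
by apply: sumr_ge0.
Unshelve. all: by end_near. Qed.

Lemma near_minimax_risk_le (e : R) : 0 < e -> \forall N \near \oo,
  (minimax_risk n N (critical N) <= (1 / 2 + e)%:E)%E.
Proof.
move=> e0; have [K K0 HK] := near_tail_factor_le e0.
near=> N; have N0 : (0 < N)%N by near: N; exact: nbhs_infty_gt.
apply: le_trans (minimax_risk_le N (critical N) n0) _.
rewrite EFinD; apply: leeD2l.
(* At the critical level [exp (- A ^ 2 n ^ 2 / 2)] is [N ^ (- 2 n)]. *)
apply: (@le_trans _ _ (\sum_(b in blocks n N)
    ((N%:R ^- (n + n)) * tail_factor K (n ^ 2)%:R (critical N))%:E)%E).
  apply: lee_sum => b bB; rewrite -(inner_block_self (R := R) bB).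
  apply: le_trans (sharp_tail (block_indicator b) (sqrtr_ge0 _) K0) _.
  rewrite lee_fin (inner_block_self bB) critical_sqr//.
  rewrite (_ : - _ = - ((n + n)%:R * ln N%:R)); last first.
    by rewrite natrD natrX; field; exact: lt0r_neq0.
  rewrite expRN mulr_natl -lnXn ?ltr0n// lnK// posrE exprn_gt0// ltr0n //.
rewrite sumEFin lee_fin sumr_const card_blocks -[leLHS]mulr_natl mulrA.
have tf : tail_factor K (n ^ 2)%:R (critical N) <= e by near: N.
apply: le_trans tf.
rewrite ger_pMl.
  rewrite ler_pdivrMr ?mul1r ?exprn_gt0 ?ltr0n// -natrX ler_nat addnn -muln2 expnM.
  by rewrite leq_exp2r// leq_bin_exp.
by rewrite /tail_factor ltr_pwDr ?expR_gt0// divr_ge0 ?expR_ge0.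
Unshelve. all: by end_near. Qed.

(** At most [C D exp (- r ln N)] of the [C = 'C(N, n)] sets of rows share [r]
    rows with a given one, so the average of the pair bounds is at most
    [D ^ 2 (n + 1) ^ 2] times the largest term. *)
Lemma near_minimax_risk_ge (e : R) : 0 < e -> \forall N \near \oo,
  ((1 / 2 - e)%:E <= minimax_risk n N (critical N))%E.
Proof.
move=> e0; pose D : R := (2 ^ n * (2 ^ n * n`!))%:R.
have D0 : 0 < D by rewrite ltr0n !muln_gt0 !expn_gt0 fact_gt0.
pose e1 := e / (D ^+ 2 * n.+1%:R ^+ 2).
have e10 : 0 < e1 by rewrite divr_gt0// mulr_gt0// exprn_gt0// ltr0n.
have [K K0 HK] := near_pair_bound_le e10.
near=> N; have N0 : (0 < N)%N by near: N; exact: nbhs_infty_gt.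
have nN : (n.*2 <= N)%N by near: N; exact: nbhs_infty_ge.
have nN' : (n <= N)%N by rewrite (leq_trans _ nN)// -addnn leq_addr.
apply: le_trans (minimax_risk_ge_blocks (A := critical N) _ n0 K0 nN'); last exact: sqrtr_ge0.
rewrite lee_fin lerD2l lerN2.
set C : R := 'C(N, n)%:R; have C0 : 0 < C by rewrite ltr0n bin_gt0.
have C20 : 0 < C ^+ 2 by rewrite exprn_gt0.
have N0' : 0 < N%:R :> R by rewrite ltr0n.
have cnt r : (r <= n)%N ->
    (2 ^ n * N ^ (n - r))%:R <= C * (D * expR (- (r%:R * ln N%:R))) :> R.
  move=> rn; rewrite expRN mulr_natl -lnXn// lnK ?posrE ?exprn_gt0//.
  rewrite mulrA ler_pdivlMr ?exprn_gt0// -natrX -!natrM ler_nat.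
  by rewrite -mulnA -expnD subnK// mulnCA leq_mul2l mulnC leq_exp_bin ?orbT.
have pb : forall r c, (r <= n)%N -> (c <= n)%N ->
    expR (- (r%:R * ln N%:R)) * expR (- (c%:R * ln N%:R)) *
      pair_bound n K (critical N) r c <= e1 by near: N.
apply: (@le_trans _ _ ((C ^+ 2)^-1 / 2 *
    \sum_(r < n.+1) \sum_(c < n.+1) (C ^+ 2 * D ^+ 2 * e1))).
  apply: ler_wpM2l; first by rewrite divr_ge0// invr_ge0 ltW.
  apply: ler_sum => r _; apply: ler_sum => c _.
  have rn : (r <= n)%N by rewrite -ltnS.
  have cn : (c <= n)%N by rewrite -ltnS.
  apply: (@le_trans _ _ (C ^+ 2 * D ^+ 2 *
    (expR (- (r%:R * ln N%:R)) * expR (- (c%:R * ln N%:R)) *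
      pair_bound n K (critical N) r c))); last first.
    by apply: ler_wpM2l (pb _ _ rn cn); rewrite mulr_ge0// sqr_ge0.
  rewrite mulrA; apply: ler_wpM2r; first exact: pair_bound_ge0.
  apply: le_trans (ler_pM _ _ (cnt _ rn) (cnt _ cn)) _ => //.
  by rewrite le_eqVlt; apply/orP; left; apply/eqP; ring.
rewrite !sumr_const !card_ord -mulrnA -[X in _ * X]mulr_natl natrM /e1.
rewrite [leLHS](_ : _ = e / 2); first by lra.
by field; rewrite !lt0r_neq0// ltr0n.
Unshelve. all: by end_near. Qed.

End critical_level.

Theorem theorem2p5 (R : realType) (n : nat) (hn : (1 <= n)%N) :
  minimax_risk n N (Num.sqrt (4 * ln N%:R / n%:R)) @[N --> \oo]
    --> ((1 / 2 : R)%:E).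
Proof.
apply/fine_cvgP; split.
  near=> N.
  have le_risk : (minimax_risk n N (critical n N) <= (1 / 2 + 1 : R)%:E)%E.
    by near: N; exact: near_minimax_risk_le.
  have ge_risk : ((1 / 2 - 1 : R)%:E <= minimax_risk n N (critical n N))%E.
    by near: N; exact: near_minimax_risk_ge.
  by rewrite fin_numElt (lt_le_trans _ ge_risk) ?ltNyr// (le_lt_trans le_risk) ?ltry.
apply/cvgrPdist_le => e e0; near=> N.
have le_risk : (minimax_risk n N (critical n N) <= (1 / 2 + e : R)%:E)%E.
  by near: N; exact: near_minimax_risk_le.
have ge_risk : ((1 / 2 - e : R)%:E <= minimax_risk n N (critical n N))%E.
  by near: N; exact: near_minimax_risk_ge.
have : minimax_risk n N (critical n N : R) \is a fin_num.
  by rewrite fin_numElt (lt_le_trans _ ge_risk) ?ltNyr// (le_lt_trans le_risk) ?ltry.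
rewrite /= -/(critical n N) => /fineK fin_risk.
move: le_risk ge_risk; rewrite -fin_risk !lee_fin => le_risk ge_risk.
by rewrite ler_distlC; apply/andP; split; lra.
Unshelve. all: by end_near. Qed.
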